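(* Assume $T$ is $\mathrm{NTP}_2$. Let $p(x)$ be a dependent partial type over a set $A$ and let $\kappa$ be a cardinal such that $\operatorname{rk-dp}(p)\geq\kappa$ (i.e. it is not the case that $\operatorname{rk-dp}(p)<\kappa$). Then there exist a set $A'\supseteq A$, a realization $a\models p$, and sequences $\{I_i\mid i<\kappa\}$ mutually indiscernible over $A'$ such that each $I_i$ is not indiscernible over $A'\cup\{a\}$, and every tuple in every $I_i$ realizes $p$.
   Context: $T$ is a complete first-order theory with monster model $\mathfrak{C}$; $x$ is a finite tuple of variables. A family of sequences $\{I_i\}$ is mutually indiscernible over $B$ if each $I_i$ is indiscernible over $B\cup\bigcup_{j\ne i}I_j$. For a partial type $p$ over $A$ and a cardinal $\kappa$, $\operatorname{rk-dp}(p)<\kappa$ means: for every $a\models p$ and every $\kappa$ sequences mutually indiscernible over $A$, at least one of them is indiscernible over $A\cup\{a\}$. $p$ is dependent if $\operatorname{rk-dp}(p)<\kappa$ for some cardinal $\kappa$. $T$ is $\mathrm{NTP}_2$ if there are no formula $\varphi(x,y)$, array $\langle a_{i,j}\mid i,j<\omega\rangle$ and $k<\omega$ such that for each $i$, $\{\varphi(x,a_{i,j})\mid j<\omega\}$ is $k$-inconsistent, while for every $\eta:\omega\to\omega$, $\{\varphi(x,a_{i,\eta(i)})\mid i<\omega\}$ is consistent. *)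

(* Defs.v *)
From mathcomp Require Import all_boot all_order.
From mathcomp Require Import all_classical.

Set Implicit Arguments.
Unset Strict Implicit.
Unset Printing Implicit Defensive.

Local Open Scope classical_set_scope.
Local Open Scope card_scope.

Record language := Language {
  fsym : Type;
  fsym_arity : fsym -> nat;
  rsym : Type;
  rsym_arity : rsym -> nat }.

(* [term L n], [formula L n]: the free variables are indexed by 'I_n. *)
Inductive term (L : language) (n : nat) : Type :=
| Var of 'I_n
| App (f : fsym L) of ('I_(fsym_arity f) -> term L n).

(* In [All f] the quantified variable is [ord0]; the variable i of the
   context is [lift ord0 i] in [f]. *)
Inductive formula (L : language) : nat -> Type :=
| Bot n : formula L n
| Eq n : term L n -> term L n -> formula L n
| Rel n (r : rsym L) : ('I_(rsym_arity r) -> term L n) -> formula L n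
| Imp n : formula L n -> formula L n -> formula L n
| All n : formula L n.+1 -> formula L n.

Definition Neg L n (f : formula L n) : formula L n := Imp f (Bot L n).

Record structure (L : language) := Structure {
  carrier :> Type;
  carrier_inhabited : inhabited carrier;
  fint : forall f : fsym L, ('I_(fsym_arity f) -> carrier) -> carrier;
  rint : forall r : rsym L, ('I_(rsym_arity r) -> carrier) -> Prop }.

Section Semantics.
Context {L : language} (M : structure L).

Fixpoint eval n (v : 'I_n -> M) (t : term L n) : M :=
  match t with
  | Var i => v i
  | App f args => fint (fun i => eval v (args i))
  end.

Definition env_cons n (d : M) (v : 'I_n -> M) : 'I_n.+1 -> M :=
  fun i => oapp v d (unlift ord0 i).

Fixpoint sat n (f : formula L n) : ('I_n -> M) -> Prop :=
  match f in formula _ n return ('I_n -> M) -> Prop with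
  | Bot _ => fun _ => False
  | Eq _ s t => fun v => eval v s = eval v t
  | Rel _ r args => fun v => rint (fun i => eval v (args i))
  | Imp _ f g => fun v => sat f v -> sat g v
  | All _ f => fun v => forall d : M, sat f (env_cons d v)
  end.

Definition tcat n m (a : 'I_n -> M) (b : 'I_m -> M) : 'I_(n + m) -> M :=
  fun i => match fintype.split i with inl j => a j | inr k => b k end.

Definition automorphism (s : M -> M) : Prop :=
  [/\ bijective s,
      forall f (v : 'I_(fsym_arity f) -> M), s (fint v) = fint (s \o v)
    & forall r (v : 'I_(rsym_arity r) -> M), rint (s \o v) <-> rint v].

End Semantics.

Definition theory (L : language) := set (formula L 0).

Definition models L (M : structure L) (T : theory L) : Prop :=
  forall f, T f -> forall v : 'I_0 -> M, sat f v.

Definition entails L (T : theory L) (f : formula L 0) : Prop :=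
  forall M : structure L, models M T -> forall v : 'I_0 -> M, sat f v.

Definition complete L (T : theory L) : Prop :=
  (exists M : structure L, models M T) /\
  (forall f, entails T f \/ entails T (Neg f)).

(* a formula phi(x, b), with x an n-tuple of variables *)
Record pformula L (M : structure L) (n : nat) := PFormula {
  plen : nat;
  pbody : formula L (n + plen);
  ppar : 'I_plen -> M }.

Section Types.
Context {L : language} {M : structure L}.

Definition holds n (a : 'I_n -> M) (f : pformula M n) : Prop :=
  sat (pbody f) (tcat a (@ppar _ _ _ f)).

Definition params_in (B : set M) n (f : pformula M n) : Prop :=
  forall i, B (@ppar _ _ _ f i).

Definition realizes n (a : 'I_n -> M) (p : set (pformula M n)) : Prop :=
  forall f, p f -> holds a f.

(* consistency with the elementary diagram of M *)
Definition consistent n (p : set (pformula M n)) : Prop :=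
  forall F, F `<=` p -> finite_set F -> exists a, realizes a F.

Definition partial_type (B : set M) n (p : set (pformula M n)) : Prop :=
  (forall f, p f -> params_in B f) /\ consistent p.

(* tp(u/B) = tp(v/B), for possibly infinite tuples indexed by J; [g] selects
   the coordinates that occur in the formula. *)
Definition same_type (B : set M) (J : Type) (u v : J -> M) : Prop :=
  forall N (g : 'I_N -> J) (f : pformula M N), params_in B f ->
    (holds (u \o g) f <-> holds (v \o g) f).

End Types.

Definition card_lt T U (A : set T) (B : set U) : Prop :=
  (A #<= B) /\ ~ (B #<= A).

(* "Small" means of cardinality smaller than that of [kbar], an uncountable
   strong limit cardinal larger than the cardinality of the language. *)
Record monster L (T : theory L) := Monster {
  mon :> structure L;
  kbar : Type;
  mon_models : models mon T;
  kbar_nat : card_lt [set: nat] [set: kbar];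
  kbar_fsym : card_lt [set: fsym L] [set: kbar];
  kbar_rsym : card_lt [set: rsym L] [set: kbar];
  kbar_strong_limit : forall X : Type,
    card_lt [set: X] [set: kbar] -> card_lt [set: set X] [set: kbar];
  mon_saturated : forall (B : set mon) (p : set (pformula mon 1)),
    card_lt B [set: kbar] -> partial_type B p -> exists a, realizes a p;
  mon_homogeneous : forall (J : Type) (u v : J -> mon),
    card_lt [set: J] [set: kbar] -> same_type set0 u v ->
    exists2 s : mon -> mon, automorphism s & forall j, s (u j) = v j }.

Definition small L (T : theory L) (C : monster T) X (A : set X) : Prop :=
  card_lt A [set: kbar C].

Section NTP2.
Context {L : language} {T : theory L} (C : monster T).

(* k-inconsistency of a family is about k distinct indices, even if some
   members of the family coincide. *)
Definition k_inconsistent n (k : nat) (F : nat -> pformula C n) : Prop :=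
  forall j : 'I_k -> nat, injective j -> ~ consistent [set F (j l) | l in setT].

Definition TP2_witness n m (phi : formula L (n + m))
    (a : nat -> nat -> 'I_m -> C) (k : nat) : Prop :=
  (forall i, k_inconsistent k (fun j => PFormula phi (a i j))) /\
  (forall eta : nat -> nat,
     consistent [set PFormula phi (a i (eta i)) | i in setT]).

Definition NTP2 : Prop :=
  ~ exists n m (phi : formula L (n + m)) (a : nat -> nat -> 'I_m -> C) k,
      TP2_witness phi a k.

End NTP2.

(* infinite sequences of m-tuples, along an arbitrary linear order *)
Record sequence (M : Type) (m : nat) := Sequence {
  sdisp : Order.disp_t;
  sidx : orderType sdisp;
  sidx_infinite : infinite_set [set: sidx];
  sentry :> sidx -> 'I_m -> M }.

Definition elements M m (I : sequence M m) : set M :=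
  [set c | exists o t, I o t = c].

Section DpRank.
Context {L : language} {T : theory L} {C : monster T}.

Definition indiscernible (B : set C) m (I : sequence C m) : Prop :=
  forall k (s t : 'I_k -> sidx I),
    {homo s : i j / (i < j)%N >-> (i < j)%O} ->
    {homo t : i j / (i < j)%N >-> (i < j)%O} ->
    same_type B (fun q : 'I_k * 'I_m => I (s q.1) q.2)
                (fun q : 'I_k * 'I_m => I (t q.1) q.2).

Definition mutually_indiscernible (B : set C) (K : Type) (m : K -> nat)
    (I : forall i, sequence C (m i)) : Prop :=
  forall i, indiscernible
    (B `|` \bigcup_(j in [set j | j <> i]) elements (I j)) (I i).

(* rk-dp(p) < kappa, where p is over A and kappa is the cardinality of K *)
Definition rk_dp_lt (A : set C) n (p : set (pformula C n)) (K : Type) : Prop :=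
  forall (a : 'I_n -> C) (m : K -> nat) (I : forall i, sequence C (m i)),
    realizes a p ->
    (forall i, small C [set: sidx (I i)]) ->
    mutually_indiscernible A I ->
    exists i, indiscernible (A `|` range a) (I i).

(* Cardinals are small: the condition is vacuous for K larger than C. *)
Definition dependent (A : set C) n (p : set (pformula C n)) : Prop :=
  exists K : Type, small C [set: K] /\ rk_dp_lt A p K.

End DpRank.

(* Main.v *)
Require Import Defs.
From Stdlib Require List.
From mathcomp Require Import all_boot all_order all_algebra archimedean zify lra.
From mathcomp Require Import all_classical.

(* Put D = option K and call a family y of n-tuples indexed by D -> rat good if
   the type of a finite subfamily depends only on the order types of its indices
   in each dimension.  An inp-type pattern extracted from the failure of
   rk-dp(p) < K, with b_(i,q) and phi_i true at q = eta(i) and false for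
   q > eta(i), becomes a good family of realizations of p by iterated
   ultrafilter limits and saturation.  In a fixed dimension i one looks at rows
   of letters which increase in all the other dimensions.  If prepending a letter
   never destroyed the indiscernibility of such a row, all words in two letters
   would have the type of a chain, and phi_i would cut a chain in all possible
   ways; this is excluded because p is dependent.  So for every i there is a row
   and a letter breaking it.  Sending all these letters to the same index and
   the rows, for different i, to disjoint shells around it makes the rows
   mutually indiscernible over the remaining parameters; the common letter is a.
   Saturation extends this from finitely many i to all of K. *)

(** A good family sees only the order of its indices in each dimension, so the configurations found
    for different i can be moved and rescaled, dimension by dimension, before they are put together.
    This is how one letter can break all rows: each configuration is translated until its breaking
    letter is at the origin. Mutual indiscernibility then asks that, apart from this letter, every
    index lie in each dimension on one side of a row to which it does not belong. In dimension i the
    row of i therefore stays near 0 while the other rows are pushed away from 0; in every other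
    dimension it gets a shell of its own. Shells are numbered by natural numbers and K may be
    uncountable, which is why only finitely many i are arranged at a time. Iterated limits along an
    ultrafilter do the work of Ramsey's theorem and treat one dimension after another. The letters
    of a word increase in the other dimensions, so a word that repeats a value still consists of
    distinct indices, and outside of dimension i it cannot be told from a chain. *)

Set Implicit Arguments.
Unset Strict Implicit.
Unset Printing Implicit Defensive.
Import Order.TTheory GRing.Theory Num.Theory.

Local Open Scope classical_set_scope.

(** * Small cardinals *)

Section Cardinals.
Local Open Scope card_scope.

Lemma card_leE T U (A : set T) (B : set U) :
  (A #<= B) <-> exists f : A -> B, injective f.
Proof.
split=> [/card_leP[f]|[f injf]].
  by exists f => x y; apply: (@inj _ _ _ f); rewrite inE.
by apply/card_leP/injfunPex; exists f => // x y _ _ /injf.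
Qed.

Lemma card_le_injE X Y : ([set: X] #<= [set: Y]) <-> exists f : X -> Y, injective f.
Proof.
rewrite card_leE; split=> -[f injf].
  exists (fun x => val (f (SigSub (mem_set (I : [set: X] x))))) => x y /val_inj/injf.
  by move=> /(congr1 val).
exists (fun x => SigSub (mem_set (I : [set: Y] (f (val x))))) => x y.
by move=> /(congr1 val)/= /injf/val_inj.
Qed.

Lemma card_set_type T (A : set T) : [set: A] #<= A.
Proof.
apply/card_leE; exists (fun x => val x) => x y; exact: val_inj.
Qed.

(** A partial injection is a relation in which equality of first and equality of second components
    are equivalent. A maximal one is total on one of the two sides, as otherwise a pair could be
    added. *)
Lemma card_le_total T U (A : set T) (B : set U) : A #<= B \/ B #<= A.
Proof.
pose partial_inj (R : set (A * B)) := forall u v, R u -> R v ->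
  (u.1 = v.1 <-> u.2 = v.2).
have [F FR totF|R [Rinj Rmax]] := @Zorn_bigcup _ partial_inj.
  move=> u v [R FR0 Ru] [S FS Sv].
  have [RS|SR] := totF _ _ FR0 FS.
    by apply: (FR S FS) => //; exact: RS.
  by apply: (FR R FR0) => //; exact: SR.
have [/choice[f fP]|/existsNP[a aN]] := pselect (forall a, exists b, R (a, b)).
  left; apply/card_leE; exists f => x y fxy.
  by apply/(Rinj (x, f x) (y, f y)).
have [/choice[f fP]|/existsNP[b bN]] := pselect (forall b, exists a, R (a, b)).
  right; apply/card_leE; exists f => x y fxy.
  by apply/(Rinj (f x, x) (f y, y)).
exfalso; apply: (Rmax (R `|` [set (a, b)])).
  split; first by move=> u; left.
  by move=> /(_ (a, b))RN; apply: aN; exists b; apply: RN; right.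
move=> [a1 b1] [a2 b2] [R1|[-> ->]] [R2|[-> ->]] //=.
- exact: (Rinj _ _ R1 R2).
- by split=> E; [case: aN; exists b1; rewrite -E|case: bN; exists a1; rewrite -E].
- by split=> E; [case: aN; exists b2; rewrite E|case: bN; exists a2; rewrite E].
Qed.

End Cardinals.

Section Small.
Context {L : language} {T : theory L} (C : monster T).
Local Open Scope card_scope.

Definition smallT (X : Type) : Prop := card_lt [set: X] [set: kbar C].

Lemma card_lt_le X Y (A : set X) (B : set Y) :
  A #<= B -> card_lt B [set: kbar C] -> card_lt A [set: kbar C].
Proof.
move=> AB [Bk kB]; split; first exact: card_le_trans Bk.
by apply: contra_not kB => /card_le_trans; apply.
Qed.

Lemma smallT_inj X Y (f : X -> Y) : injective f -> smallT Y -> smallT X.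
Proof. by move=> injf; apply: card_lt_le; apply/card_le_injE; exists f. Qed.

Lemma smallT_not_inj X Y : smallT X -> ~ smallT Y -> exists f : X -> Y, injective f.
Proof.
move=> sX nsY; apply/card_le_injE.
have [//|YX] := card_le_total [set: X] [set: Y].
by case: nsY; exact: card_lt_le YX sX.
Qed.

Lemma smallT_set X : smallT X -> smallT (set X).
Proof. exact: kbar_strong_limit. Qed.

Lemma smallT_nat : smallT nat.
Proof. exact: kbar_nat. Qed.

Lemma smallT_count (X : countType) : smallT X.
Proof. exact: (smallT_inj (pcan_inj choice.pickleK) smallT_nat). Qed.

(** Coding by Kuratowski pairs gives closure under products from the strong limit property alone,
    without arithmetic of infinite cardinals. *)
Lemma smallT_sqr X : smallT X -> smallT (X * X).
Proof.
move=> sX; apply: (@smallT_inj _ (set (set X))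
  (fun u => [set A | A = [set u.1] \/ A = [set u.1; u.2]])); last first.
  by do 2 apply: smallT_set.
move=> [x y] [x' y'] /= E.
have xx' : x = x'.
  have : [set A | A = [set x'] \/ A = [set x'; y']] [set x].
    by rewrite -E; left.
  move=> /=[/seteqP[+ _]|/seteqP[_]]; first by apply.
  by move=> /(_ x' (or_introl erefl)) /= ->.
rewrite -xx' in E *; congr (_, _).
have E1 : [set A | A = [set x] \/ A = [set x; y']] [set x; y].
  by rewrite -E; right.
have E2 : [set A | A = [set x] \/ A = [set x; y]] [set x; y'].
  by rewrite E; right.
have Y : [set x; y] y by right.
have Y' : [set x; y'] y' by right.
case: E1 => /= E1; rewrite E1 in Y.
  rewrite Y; case: E2 => /= E2; rewrite E2 in Y'; first by rewrite Y'.
  by move: Y'; rewrite E1 => ->.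
case: Y => // /= Y; case: E2 => /= E2; rewrite E2 in Y'; first by rewrite Y Y'.
by case: Y' => //= ->.
Qed.

Lemma smallT_prod X Y : smallT X -> smallT Y -> smallT (X * Y).
Proof.
move=> sX sY.
have [/card_le_injE[f injf]|/card_le_injE[f injf]] := card_le_total [set: X] [set: Y].
  apply: (@smallT_inj _ _ (fun u => (f u.1, u.2)) _ (smallT_sqr sY)).
  by move=> [x y] [x' y'] /= [/injf -> ->].
apply: (@smallT_inj _ _ (fun u => (u.1, f u.2)) _ (smallT_sqr sX)).
by move=> [x y] [x' y'] /= [-> /injf ->].
Qed.

Lemma smallT_fun X Y : smallT X -> smallT Y -> smallT (X -> Y).
Proof.
move=> sX sY; apply: (@smallT_inj _ (set (X * Y)) (fun f => [set u | u.2 = f u.1])).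
  move=> f g E; apply/funext => x.
  have : [set u | u.2 = g u.1] (x, f x) by rewrite -E.
  by [].
by apply/smallT_set/smallT_prod.
Qed.

Lemma smallT_sum X Y : smallT X -> smallT Y -> smallT (X + Y).
Proof.
move=> sX sY; have [[x]|nX] := pselect (inhabited X); last first.
  apply: (@smallT_inj _ Y (fun u => match u with
    inl x => False_rect _ (nX (inhabits x)) | inr y => y end)) => //.
  by move=> [x|y]; [case: (nX (inhabits x))|move=> [x|y']; [case: (nX (inhabits x))|move=> ->]].
have [[y]|nY] := pselect (inhabited Y); last first.
  apply: (@smallT_inj _ X (fun u => match u with
    inl x => x | inr y => False_rect _ (nY (inhabits y)) end)) => //.
  by move=> [x1|y]; [move=> [x2|y]; [move=> ->|case: (nY (inhabits y))]|case: (nY (inhabits y))].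
apply: (@smallT_inj _ (bool * (X * Y)) (fun u => match u with
  inl x' => (true, (x', y)) | inr y' => (false, (x, y')) end)); last first.
  by apply: smallT_prod; [exact: smallT_count|exact: smallT_prod].
by move=> [a|a] [b|b] //= [->].
Qed.

Lemma smallT_option X : smallT X -> smallT (option X).
Proof.
move=> sX; apply: (@smallT_inj _ (unit + X) (fun u => match u with
  None => inl tt | Some x => inr x end)).
  by move=> [a|] [b|] //= [->].
by apply: smallT_sum => //; exact: smallT_count.
Qed.

Lemma small_range X (f : X -> C) (A : set C) :
  smallT X -> A `<=` range f -> small C A.
Proof.
move=> sX Af; apply: (card_lt_le _ sX).
by apply: card_le_trans (card_image_le f _); exact: subset_card_le.
Qed.

Lemma small_set_type (A : set C) : small C A -> smallT A.
Proof. by apply: card_lt_le; exact: card_set_type. Qed.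

Lemma smallU (A B : set C) : small C A -> small C B -> small C (A `|` B).
Proof.
move=> /small_set_type sA /small_set_type sB.
apply: (@small_range (A + B) (fun u => match u with
  inl a => val a | inr b => val b end)); first exact: smallT_sum.
move=> x [Ax|Bx]; first by exists (inl (SigSub (mem_set Ax))).
by exists (inr (SigSub (mem_set Bx))).
Qed.

End Small.

(** * Definable relations in arbitrarily many variables *)

Section Definability.
Context {L : language} (M : structure L).

Fixpoint rent n m (r : 'I_n -> 'I_m) (t : term L n) : term L m :=
  match t with
  | Var i => Var L (r i)
  | App f args => App (fun i => rent r (args i))
  end.

Definition lift_ren n m (r : 'I_n -> 'I_m) : 'I_n.+1 -> 'I_m.+1 :=
  fun i => oapp (lift ord0 \o r) ord0 (unlift ord0 i).

Fixpoint renf n (f : formula L n) : forall m, ('I_n -> 'I_m) -> formula L m :=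
  match f in formula _ n return forall m, ('I_n -> 'I_m) -> formula L m with
  | Bot _ => fun m _ => Bot L m
  | Eq _ s t => fun m r => Eq (rent r s) (rent r t)
  | Rel _ R args => fun m r => Rel (fun i => rent r (args i))
  | Imp _ f g => fun m r => Imp (renf f r) (renf g r)
  | All _ f => fun m r => All (renf f (lift_ren r))
  end.

Lemma eval_rent n m (r : 'I_n -> 'I_m) (t : term L n) (v : 'I_m -> M) :
  eval v (rent r t) = eval (v \o r) t.
Proof. by elim: t => //= f args IH; congr fint; apply/funext => i; exact: IH. Qed.

Lemma env_cons_lift n m (r : 'I_n -> 'I_m) (v : 'I_m -> M) d :
  env_cons d v \o lift_ren r = env_cons d (v \o r).
Proof.
apply/funext => i /=; rewrite /env_cons /lift_ren.
by case: (unliftP ord0 i) => [j|] _ /=; rewrite ?liftK ?unlift_none.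
Qed.

Lemma sat_renf n (f : formula L n) m (r : 'I_n -> 'I_m) (v : 'I_m -> M) :
  sat (renf f r) v <-> sat f (v \o r).
Proof.
elim: f m r v => //= [k s t|k R args|k f IHf g IHg|k f IH] m r v.
- by rewrite !eval_rent.
- by under [in X in X <-> _]eq_fun do rewrite eval_rent.
- by rewrite IHf IHg.
- by split=> H d; move: (H d); rewrite IH env_cons_lift.
Qed.

Definition asgn N J (h : 'I_N -> J + M) (v : J -> M) : 'I_N -> M :=
  fun k => match h k with inl j => v j | inr c => c end.

(* Parameters sit among the variables, so that variables can be traded for
   parameters without touching the formula. *)
Definition dfn (B : set M) J (P : (J -> M) -> Prop) : Prop :=
  exists N (f : formula L N) (h : 'I_N -> J + M),
    (forall k c, h k = inr c -> B c) /\ forall v, P v <-> sat f (asgn h v).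

Lemma dfn_ext B J (P Q : (J -> M) -> Prop) :
  (forall v, P v <-> Q v) -> dfn B P -> dfn B Q.
Proof.
move=> PQ [N [f [h [hB hP]]]]; exists N, f, h; split=> // v.
by rewrite -PQ.
Qed.

Lemma dfn_subset (B B' : set M) J (P : (J -> M) -> Prop) :
  B `<=` B' -> dfn B P -> dfn B' P.
Proof.
by move=> BB [N [f [h [hB hP]]]]; exists N, f, h; split=> // k c /hB /BB.
Qed.

Lemma dfn_false B J : dfn B (fun _ : J -> M => False).
Proof.
have h : 'I_0 -> J + M by case.
by exists 0, (Bot L 0), h; split=> // -[].
Qed.

Lemma dfn_imp B J (P Q : (J -> M) -> Prop) :
  dfn B P -> dfn B Q -> dfn B (fun v => P v -> Q v).
Proof.
move=> [N [f [h [hB hP]]]] [N' [f' [h' [hB' hQ]]]].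
exists (N + N'), (Imp (renf f (@lshift N N')) (renf f' (@rshift N N'))).
exists (fun k => match fintype.split k with inl j => h j | inr j => h' j end).
split=> [k c|v /=]; first by case: fintype.split => j; [exact: hB|exact: hB'].
rewrite hP hQ !sat_renf.
suff [-> ->] : (asgn h v = asgn (fun k => match fintype.split k with
    inl j => h j | inr j => h' j end) v \o @lshift N N') /\
  (asgn h' v = asgn (fun k => match fintype.split k with
    inl j => h j | inr j => h' j end) v \o @rshift N N') by [].
by split; apply/funext => k; rewrite /asgn /=;
  [rewrite (unsplitK (inl k))|rewrite (unsplitK (inr k))].
Qed.

Lemma dfn_not B J (P : (J -> M) -> Prop) : dfn B P -> dfn B (fun v => ~ P v).
Proof. by move=> dP; apply: dfn_imp (dfn_false _ _). Qed.

Lemma dfn_and B J (P Q : (J -> M) -> Prop) :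
  dfn B P -> dfn B Q -> dfn B (fun v => P v /\ Q v).
Proof.
move=> dP dQ; apply: dfn_ext (dfn_not (dfn_imp dP (dfn_not dQ))) => v.
by split=> [H|[p q] /(_ p)//]; apply/and_comm; apply: contrapT => K; apply: H => p q; apply: K.
Qed.

Lemma dfn_conj B J (Ps : seq ((J -> M) -> Prop)) :
  (forall P, List.In P Ps -> dfn B P) ->
  dfn B (fun v => forall P, List.In P Ps -> P v).
Proof.
elim: Ps => [|P Ps IH] dPs.
  by apply: dfn_ext (dfn_not (dfn_false _ _)) => v; split=> // _ ?.
have dP : dfn B P by apply: dPs; left.
have := dfn_and dP (IH (fun Q QPs => dPs Q (or_intror QPs))).
apply: dfn_ext => v; split=> [[Pv PsV] Q /= [<-//|/PsV//]|H].
by split=> [|Q QPs]; apply: H; [left|right].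
Qed.

Definition upd J (v : J -> M) (j : J) (c : M) : J -> M :=
  fun i => if pselect (i = j) then c else v i.

Lemma dfn_all B J (j : J) (P : (J -> M) -> Prop) :
  dfn B P -> dfn B (fun v => forall c, P (upd v j c)).
Proof.
move=> [N [f [h [hB hP]]]].
(* Several positions may carry the variable [j]; all of them are sent to the new bound variable. *)
pose r (k : 'I_N) : 'I_N.+1 := match h k with
  inl i => if pselect (i = j) then ord0 else lift ord0 k | inr _ => lift ord0 k end.
exists N, (All (renf f r)), h; split=> // v.
suff E c : asgn h (upd v j c) = env_cons c (asgn h v) \o r.
  by rewrite /=; split=> H c; move: (H c); rewrite hP sat_renf E.
apply/funext => k /=; rewrite /asgn /upd /r /env_cons.
case hk : (h k) => [i|d]; last by rewrite liftK /= hk.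
by case: pselect => ij; rewrite ?unlift_none ?liftK //= hk.
Qed.

Lemma dfn_ex B J (j : J) (P : (J -> M) -> Prop) :
  dfn B P -> dfn B (fun v => exists c, P (upd v j c)).
Proof.
move=> /dfn_not/(dfn_all j)/dfn_not; apply: dfn_ext => v.
by rewrite -existsNP; split=> -[c]; [move/contrapT|]; exists c.
Qed.

Lemma dfn_exists B J (js : seq J) (P : (J -> M) -> Prop) :
  dfn B P ->
  dfn B (fun v => exists w, (forall j, ~ List.In j js -> w j = v j) /\ P w).
Proof.
move=> dP; elim: js => [|j js IH].
  apply: dfn_ext dP => v; split=> [Pv|[w [wv Pw]]]; first by exists v.
  by have <- : w = v by apply/funext => i; exact: wv.
apply: dfn_ext (dfn_ex j IH) => v; split=> [[c [w [wv Pw]]]|[w [wv Pw]]].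
  exists w; split=> // i /= /not_orP[ji /wv ->].
  by rewrite /upd; case: pselect => // ij; case: ji.
exists (w j), w; split=> // i njs; rewrite /upd.
by case: pselect => [ij /=|ij /=]; [rewrite ij|apply: wv => -[/esym|]].
Qed.

Lemma dfn_subst B J J' (s : J -> J' + M) (P : (J -> M) -> Prop) :
  (forall j c, s j = inr c -> B c) -> dfn B P ->
  dfn B (fun v : J' -> M => P (fun j => match s j with inl i => v i | inr c => c end)).
Proof.
move=> sB [N [f [h [hB hP]]]].
exists N, f, (fun k => match h k with inl j => s j | inr c => inr c end).
split=> [k c|v].
  by case E : (h k) => [j|d] => [/sB//|[<-]]; exact: hB E.
rewrite hP; suff -> : asgn h (fun j => match s j with inl i => v i | inr c => c end) =
   asgn (fun k => match h k with inl j => s j | inr c => inr c end) v by [].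
by apply/funext => k; rewrite /asgn; case: (h k).
Qed.

Lemma dfn_comp B J J' (s : J -> J') (P : (J -> M) -> Prop) :
  dfn B P -> dfn B (fun v : J' -> M => P (v \o s)).
Proof. by move=> dP; apply: (@dfn_subst B J J' (inl \o s)) dP. Qed.

Lemma dfn_support B J (P : (J -> M) -> Prop) : dfn B P ->
  exists js : seq J, forall v w, (forall j, List.In j js -> v j = w j) -> P v <-> P w.
Proof.
move=> [N [f [h [hB hP]]]].
exists (pmap (fun k => match h k with inl j => Some j | inr _ => None end) (enum 'I_N)).
move=> v w vw; rewrite !hP.
suff -> : asgn h v = asgn h w by [].
apply/funext => k; rewrite /asgn; case hk : (h k) => [j|//]; apply: vw.
elim: (enum 'I_N) (mem_enum 'I_N k) => //= i s IH; rewrite inE => /orP[/eqP <-|].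
  by rewrite hk; left.
by move=> /IH; case: (h i) => //= i'; right.
Qed.

Lemma sat_tcat_l n m (f : formula L n) (a : 'I_n -> M) (b : 'I_m -> M) :
  sat (renf f (@lshift n m)) (tcat a b) <-> sat f a.
Proof.
rewrite sat_renf; suff -> : tcat a b \o @lshift n m = a by [].
by apply/funext => k; rewrite /tcat /= (unsplitK (inl k)).
Qed.

Lemma dfn_holds B J N (g : 'I_N -> J) (f : pformula M N) :
  params_in B f -> dfn B (fun v : J -> M => holds (v \o g) f).
Proof.
case: f => m f par pB; exists (N + m), f.
exists (fun k => match fintype.split k with inl j => inl (g j) | inr i => inr (par i) end).
split=> [k c|v]; first by case: fintype.split => // i [<-]; exact: pB.
rewrite /holds /=; suff -> : tcat (v \o g) par = asgn (fun k =>
  match fintype.split k with inl j => inl (g j) | inr i => inr (par i) end) v by [].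
by apply/funext => k; rewrite /tcat /asgn; case: fintype.split.
Qed.

Lemma dfn_pformula B J (P : (J -> M) -> Prop) (j0 : J) : dfn B P ->
  exists N (g : 'I_N -> J) (f : pformula M N),
    params_in B f /\ forall v, P v <-> holds (v \o g) f.
Proof.
move=> [N [f [h [hB hP]]]]; exists N.
exists (fun k => match h k with inl j => j | inr _ => j0 end).
(* Every position gets a parameter slot, so positions of variables need a filler from [B]. If [B] is
   empty, all positions carry variables and there are no slots. *)
have [[b Bb]|nB] := pselect (exists b, B b).
  pose r (k : 'I_N) := match h k with inl j => lshift N k | inr _ => rshift N k end.
  exists (PFormula (renf f r) (fun k => match h k with inl _ => b | inr c => c end)).
  split=> [k /=|v]; first by case E : (h k) => // [c]; exact: hB E.
  rewrite hP /holds /= sat_renf; set a := asgn _ _; set a' := _ \o r.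
  suff -> : a = a' by [].
  apply/funext => k; rewrite /a /a' /asgn /r /tcat /=; case E : (h k).
    by rewrite (unsplitK (inl k)) /= E.
  by rewrite (unsplitK (inr k)) /= E.
have p : 'I_0 -> M by case.
exists (PFormula (renf f (@lshift N 0)) p); split=> [[]//|v].
rewrite hP /holds /= sat_tcat_l; set a := asgn _ _; set a' := _ \o _.
suff -> : a = a' by [].
apply/funext => k; rewrite /a /a' /asgn /=; case E : (h k) => [//|c].
by case: nB; exists c; exact: hB E.
Qed.

Lemma dfn_pformula1 B n (P : ('I_n.+1 -> M) -> Prop) : dfn B P ->
  exists f : pformula M n.+1, params_in B f /\ forall v, P v <-> holds v f.
Proof.
move=> /(dfn_pformula ord0) [N [g [[m f par] [fB hP]]]].
exists (PFormula (renf f (fun k => match fintype.split k with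
  inl j => lshift m (g j) | inr i => rshift n.+1 i end)) par).
split=> // v; rewrite hP /holds /= sat_renf; set a := tcat _ _; set a' := _ \o _.
suff -> : a = a' by [].
apply/funext => k; rewrite /a /a' /tcat /=; case: (fintype.split k) => j /=.
  by rewrite (unsplitK (inl (g j))).
by rewrite (unsplitK (inr j)).
Qed.

(** Formulas with numbered variables are hereby traded for [dfn] relations on families with
    arbitrary index types. *)
Lemma same_typeP B J (u v : J -> M) :
  same_type B u v <-> forall P : (J -> M) -> Prop, dfn B P -> (P u <-> P v).
Proof.
split=> [H P dP|H N g f fB]; last exact: H (dfn_holds g fB).
have [[j0]|nJ] := pselect (inhabited J); last first.
  by suff -> : u = v by []; apply/funext => j; case: nJ.
have [N [g [f [fB hP]]]] := dfn_pformula j0 dP.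
by rewrite !hP; exact: H.
Qed.

End Definability.

(** * Saturation for small sets of variables *)

Lemma finite_set_list T (A : set T) : finite_set A ->
  exists s : seq T, forall x, A x -> List.In x s.
Proof.
move=> /(@finite_seqP {classic T})[s ->]; exists s => x /=.
elim: s => //= y s IH; rewrite inE => /orP[/eqP ->|/IH]; by [left|right].
Qed.

Lemma list_choice T U (R : T -> U -> Prop) (s : seq T) :
  (forall x, List.In x s -> exists y, R x y) ->
  exists s' : seq U, (forall y, List.In y s' -> exists2 x, List.In x s & R x y) /\
    (forall x, List.In x s -> exists2 y, List.In y s' & R x y).
Proof.
elim: s => [|x s IH] H; first by exists [::]; split=> // ? [].
have [y xy] := H x (or_introl erefl).
have [s' [s'1 s'2]] := IH (fun z zs => H z (or_intror zs)).
exists (y :: s'); split=> [z /= [<-|/s'1[w ws Rwz]]|z /= [<-|/s'2[w ws Rwz]]].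
- by exists x => //; left.
- by exists w => //; right.
- by exists y => //; left.
- by exists w => //; right.
Qed.

Section Compactness.
Context {L : language} {T : theory L} (C : monster T).
Variables (J : Type) (B : set C) (Gamma : set ((J -> C) -> Prop)).
Hypothesis (sJ : smallT C J) (sB : small C B).
Hypothesis GammaB : forall P, Gamma P -> dfn B P.

(** [R] is a partial assignment; the case of an empty list [Ps] makes it single-valued. *)
Let finsat (R : set (J * C)) := forall Ps : seq ((J -> C) -> Prop),
  (forall P, List.In P Ps -> Gamma P) ->
  exists v : J -> C, (forall u, R u -> v u.1 = u.2) /\ forall P, List.In P Ps -> P v.

(** A finite list of conditions has finite support, and the values of the union on that support
    already occur in one member of the chain. A solution for this member is overwritten by the union
    elsewhere. *)
Lemma chain_finsat (F : set (set (J * C))) : finsat set0 ->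
  F `<=` finsat -> total_on F subset -> finsat (\bigcup_(X in F) X).
Proof.
move=> fs0 Ff totF Ps PsG.
have [[R0 FR0]|F0] := pselect (exists R, F R); last first.
  have [v [_ vP]] := fs0 Ps PsG; exists v; split=> // u [X FX].
  by case: F0; exists X.
have [js jsP] := dfn_support (dfn_conj (fun P PPs => GammaB (PsG P PPs))).
pose U := \bigcup_(X in F) X.
have Ufun j c c' : U (j, c) -> U (j, c') -> c = c'.
  move=> [X FX Xj] [Y FY Yj].
  have [Z [FZ Zc Zc']] : exists Z, [/\ F Z, Z (j, c) & Z (j, c')].
    have [XY|YX] := totF _ _ FX FY; first by exists Y; split=> //; exact: XY.
    by exists X; split=> //; exact: YX.
  have [//|v [vZ _]] := Ff Z FZ [::].
  by rewrite -[c](vZ _ Zc) -[c'](vZ _ Zc').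
have [R FR Rjs] : exists2 R, F R & forall j c, List.In j js -> U (j, c) -> R (j, c).
  elim: js {jsP} => [|j js [R FR IH]]; first by exists R0.
  have [[c Ujc]|nU] := pselect (exists c, U (j, c)); last first.
    by exists R => // i c /= [<- Ujc|]; [case: nU; exists c|exact: IH].
  have [X FX Xj] := Ujc.
  have [XR|RX] := totF _ _ FX FR.
    exists R => // i d /= [<- Ujd|]; last exact: IH.
    by rewrite (Ufun _ _ _ Ujd Ujc); exact: XR.
  exists X => // i d /= [<- Ujd|ijs /(IH _ _ ijs)/RX//].
  by rewrite (Ufun _ _ _ Ujd Ujc).
have [v [vR vP]] := Ff R FR Ps PsG.
have /choice[w wP] : forall j, exists x,
    (forall c, U (j, c) -> x = c) /\ ((forall c, ~ U (j, c)) -> x = v j).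
  move=> j; have [[c Ujc]|nU] := pselect (exists c, U (j, c)).
    by exists c; split=> [d Ujd|/(_ c)//]; exact: Ufun Ujc Ujd.
  by exists (v j); split=> // c Ujc; case: nU; exists c.
exists w; split=> [[j c] Ujc|]; first exact: (wP j).1.
apply/(jsP w v) => // j jjs.
have [[c Ujc]|nU] := pselect (exists c, U (j, c)).
  by rewrite ((wP j).1 _ Ujc) -[c](vR _ (Rjs _ _ jjs Ujc)).
by apply: (wP j).2 => c Ujc; apply: nU; exists c.
Qed.

(** With the unassigned coordinates quantified away, the conditions on the value at [j] form a
    1-type over [B] and the values assigned so far. These are few enough for saturation. *)
Lemma extend_finsat (R : set (J * C)) (j : J) : finsat R ->
  (forall c, ~ R (j, c)) -> exists c, finsat (R `|` [set (j, c)]).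
Proof.
move=> fsR jR; have [pt] := carrier_inhabited C.
have [//|r [rR _]] := fsR [::].
pose Rg := [set u.2 | u in R].
pose B' := B `|` Rg `|` [set pt].
have sB' : small C B'.
  apply: smallU; last first.
    by apply: (@small_range _ _ _ unit (fun=> pt)); [exact: smallT_count|move=> x ->; exists tt].
  apply: smallU => //; apply: (small_range sJ (f := r)) => _ [u Ru <-].
  by exists u.1 => //; exact: rR.
pose Q Ps (x : 'I_1 -> C) := exists v : J -> C,
  [/\ forall u, R u -> v u.1 = u.2, v j = x ord0 & forall P, List.In P Ps -> P v].
have dQ Ps : (forall P, List.In P Ps -> Gamma P) -> dfn B' (Q Ps).
  move=> PsG; have dP := dfn_conj (fun P PPs => GammaB (PsG P PPs)).
  have [js jsP] := dfn_support dP.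
  pose inD i := `[< i = j \/ exists c, R (i, c) >].
  (* Unassigned coordinates get the filler [pt]: those in the support are quantified away in [d1],
     and the conditions do not depend on the others. *)
  pose s (i : J) : 'I_1 + C := if pselect (i = j) then inl ord0 else
    inr (if pselect (exists c, R (i, c)) then r i else pt).
  have d1 := dfn_exists (seq.filter (fun i => ~~ inD i) js) dP.
  have B'B : B `<=` B' by move=> x Bx; left; left.
  have sB'' i c : s i = inr c -> B' c.
    rewrite /s; case: pselect => //= ij [<-].
    case: pselect => [[d Rd]|_] /=; last by right.
    by left; right; exists (i, d) => //=; rewrite -[d](rR _ Rd).
  apply: dfn_ext (dfn_subst sB'' (dfn_subset B'B d1)) => x.
  pose sx (i : J) : C := match s i with inl k => x k | inr c => c end.
  rewrite -/sx.
  have sxj : sx j = x ord0 by rewrite /sx /s; case: pselect.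
  have sxR u : R u -> sx u.1 = u.2.
    case: u => i c Ric; rewrite /sx /s /=; case: pselect => [ij|ij] /=.
      by move: Ric; rewrite ij => /jR.
    by case: pselect => [_|[]] /=; [exact: (rR _ Ric)|exists c].
  have Infilter i : List.In i (seq.filter (fun i => ~~ inD i) js) <->
      List.In i js /\ ~~ inD i.
    elim: js {jsP d1} => [|k js IH] /=; first by split=> // -[].
    case: ifP => kD /=; rewrite IH; split.
    - by move=> [<-|[]]; split=> //; [left|right].
    - by move=> [[<-|]]; [left|right].
    - by move=> [] ? ?; split=> //; right.
    - by move=> [[<-|//]]; rewrite kD.
  split=> [[w [wsx wP]]|[v [vR vj vP]]].
    have wD i : inD i -> w i = sx i.
      by move=> iD; apply: wsx => /Infilter[_]; rewrite iD.
    exists w; split=> //; last by rewrite wD //; apply/asboolP; left.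
    move=> [i c] Ric /=; rewrite wD; last by apply/asboolP; right; exists c.
    exact: (sxR (i, c)).
  exists (fun i => if pselect (List.In i js /\ ~~ inD i) then v i else sx i); split.
    by move=> i; case: pselect => //= iD /Infilter.
  apply/(jsP _ v) => // i ijs; case: pselect => //= niD.
  have /asboolP[->|[c Ric]] : inD i.
    by apply/negPn/negP => iD; apply: niD.
    by rewrite sxj vj.
  by rewrite [LHS](sxR _ Ric) [RHS](vR _ Ric).
pose p : set (pformula C 1) := [set f | params_in B' f /\
  exists Ps, (forall P, List.In P Ps -> Gamma P) /\ forall x, Q Ps x <-> holds x f].
have [|a ap] := mon_saturated (B := B') (p := p) sB'.
  split=> [f [] //|F Fp /finite_set_list[fs fsP]].
  pose gs := seq.filter (fun f => `[< F f >]) fs.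
  have gsF f : List.In f gs -> F f.
    rewrite /gs; elim: fs {fsP gs} => //= g fs IH; case: asboolP => //= Fg [<-//|].
    exact: IH.
  have Fgs f : F f -> List.In f gs.
    move=> Ff; move: (fsP f Ff); rewrite /gs; elim: fs {fsP gs gsF} => //= g fs IH.
    by move=> [->|/IH]; [rewrite asboolT//; left|case: asboolP => //; right].
  have [Pss [Pss1 Pss2]] := list_choice (R := fun f Ps =>
    (forall P, List.In P Ps -> Gamma P) /\ forall x, Q Ps x <-> holds x f)
    (fun f fgs => (Fp f (gsF f fgs)).2).
  have [|v [vR vP]] := fsR (List.concat Pss).
    move=> P /List.in_concat[Ps [PsPss PPs]].
    by have [f _ [+ _]] := Pss1 Ps PsPss; apply.
  exists (fun=> v j) => f /Fgs/Pss2[Ps PsPss [_ hf]]; apply/hf.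
  exists v; split=> // P PPs; apply: vP.
  by apply/List.in_concat; exists Ps.
exists (a ord0) => Ps PsG.
have [f [fB hf]] := dfn_pformula1 (dQ Ps PsG).
have [|v [vR vj vP]] := (hf a).2; first by apply: ap; split=> //; exists Ps.
by exists v; split=> // u [/vR//|->].
Qed.

Lemma compactness :
  (forall Ps : seq ((J -> C) -> Prop), (forall P, List.In P Ps -> Gamma P) ->
    exists v : J -> C, forall P, List.In P Ps -> P v) ->
  exists v : J -> C, forall P, Gamma P -> P v.
Proof.
move=> fs; have fs0 : finsat set0.
  by move=> Ps /fs[v vP]; exists v; split.
have [R [fsR Rmax]] := @Zorn_bigcup _ finsat (fun F => @chain_finsat F fs0).
have Rtot j : exists c, R (j, c).
  apply: contrapT => /forallNP jR.
  have [c fsc] := extend_finsat fsR jR.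
  apply: (Rmax (R `|` [set (j, c)])) => //; split; first by move=> u; left.
  by move=> /(_ (j, c)) RN; apply: (jR c); apply: RN; right.
have [v vR] := choice Rtot; exists v => P GP.
have [|w [wR wP]] := fsR [:: P]; first by move=> ? /= [<-|].
have <- : w = v by apply/funext => j; exact: wR _ (vR j).
by apply: wP; left.
Qed.

End Compactness.

(** * Mutually indiscernible rows *)

Lemma enum_order (I : finType) d d' (O : orderType d) (O' : orderType d')
    (f : I -> O) (g : I -> O') :
  (forall a b, (f a < f b)%O = (g a < g b)%O) ->
  exists k (s : 'I_k -> O) (t : 'I_k -> O') (r : I -> 'I_k),
    [/\ {homo s : i j / (i < j)%N >-> (i < j)%O},
        {homo t : i j / (i < j)%N >-> (i < j)%O},
        forall a, f a = s (r a) & forall a, g a = t (r a)].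
Proof.
move=> fg; pose S := sort <=%O (undup (map f (enum I))).
have fS a : f a \in S by rewrite mem_sort mem_undup map_f ?mem_enum.
have Sf i : exists a, f a = tnth (in_tuple S) i.
  have : tnth (in_tuple S) i \in S by rewrite mem_tnth.
  by rewrite mem_sort mem_undup => /mapP[a _ ->]; exists a.
have [c cP] := choice Sf.
have ltS : sorted <%O S.
  by rewrite lt_sorted_uniq_le sort_uniq undup_uniq sort_le_sorted.
have rP a : (index (f a) S < size S)%N by rewrite index_mem.
exists (size S), (tnth (in_tuple S)), (g \o c), (fun a => Ordinal (rP a)).
have sinc : {homo tnth (in_tuple S) : i j / (i < j)%N >-> (i < j)%O}.
  move=> i j ij; have x0 := tnth (in_tuple S) i; rewrite !(tnth_nth x0) /=.
  by apply: (sorted_ltn_nth lt_trans) => //; rewrite inE.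
have fr a : f a = tnth (in_tuple S) (Ordinal (rP a)).
  by rewrite (tnth_nth (f a)) /= nth_index.
split=> // [i j ij /=|a /=].
  by rewrite -fg !cP; exact: sinc.
have E : f (c (Ordinal (rP a))) = f a by rewrite cP -fr.
apply/eqP; rewrite eq_le !leNgt -!fg E ltxx //.
Qed.

(** An infinite order may have no increasing sequence of type omega, so the length [r] is fixed in
    advance and nothing is claimed beyond it. *)
Lemma infinite_inc d (O : orderType d) : infinite_set [set: O] ->
  forall r, exists e : nat -> O, {in gtn r &, {homo e : i j / (i < j)%N >-> (i < j)%O}}.
Proof.
move=> infO r.
have [s us ss] : exists2 s : seq O, uniq s & size s = r.
  elim: r => [|r [s us ss]]; first by exists [::].
  have [x xs] : exists x, x \notin s.
    apply: contrapT => /forallNP H; apply: infO.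
    apply/finite_seqP; exists s; apply/seteqP; split=> x //= _.
    by apply: contrapT => /negP; exact: H.
  by exists (x :: s); rewrite /= ?xs ?us ?ss.
case: r ss => [|r] ss.
  case: s us ss => // _ _.
  have [x _] : exists x : O, True.
    apply: contrapT => /forallNP H; apply: infO.
    by rewrite (_ : [set: O] = set0)//; apply/seteqP; split=> x //= _; case: (H x).
  by exists (fun=> x).
case: s us ss => [//|x s] us ss.
exists (nth x (sort <=%O (x :: s))) => i j; rewrite !inE => ir jr ij.
apply: (sorted_ltn_nth lt_trans); rewrite ?inE ?size_sort ?ss //.
by rewrite lt_sorted_uniq_le sort_uniq us sort_le_sorted.
Qed.

Section DefinabilityMore.
Context {L : language} (M : structure L).

Definition sum_asgn X W (v : X -> M) (w : W -> M) : X + W -> M :=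
  fun u => match u with inl x => v x | inr y => w y end.

Lemma dfn_existsW (B : set M) X W (x0 : X) (P : (X + W -> M) -> Prop) :
  dfn B P -> dfn B (fun v : X -> M => exists w : W -> M, P (sum_asgn v w)).
Proof.
move=> dP; have [js jsP] := dfn_support dP.
pose inW (u : X + W) := match u with inl _ => false | inr _ => true end.
pose s (u : X + W) : X := match u with inl x => x | inr _ => x0 end.
apply: dfn_ext (dfn_comp s (dfn_exists (seq.filter inW js) dP)) => v.
have Infilter u : List.In u (seq.filter inW js) <-> List.In u js /\ inW u.
  elim: js {jsP} => [|u' js IH] /=; first by split=> // -[].
  case: ifP => kD /=; rewrite IH; split.
  - by move=> [<-|[]]; split=> //; [left|right].
  - by move=> [[<-|]]; [left|right].
  - by move=> [] ? ?; split=> //; right.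
  - by move=> [[<-|//]]; rewrite kD.
split=> [[w [wv Pw]]|[w Pw]].
  exists (w \o inr); suff <- : w = sum_asgn v (w \o inr) by [].
  by apply/funext => -[x|y] //=; rewrite wv // => /Infilter[].
exists (fun u => if pselect (List.In u js /\ inW u) then sum_asgn v w u else v (s u)).
split=> [u nu|]; first by case: pselect => // H; case: nu; apply/Infilter.
apply/(jsP _ (sum_asgn v w)) => // u ujs; case: pselect => // nu.
by case: u ujs nu => [x //|y] ujs; case.
Qed.

Lemma dfn_range (B : set M) n (a : 'I_n -> M) J (P : (J -> M) -> Prop) :
  dfn (B `|` range a) P -> exists P' : ('I_n + J -> M) -> Prop,
    dfn B P' /\ forall v, P v <-> P' (sum_asgn a v).
Proof.
move=> [N [f [h [hB hP]]]].
have /choice[h' h'P] : forall k, exists x : ('I_n + J) + M,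
    (forall c, x = inr c -> B c) /\ forall v, asgn h v k =
      match x with inl u => sum_asgn a v u | inr c => c end.
  move=> k; rewrite /asgn; case E : (h k) => [j|c]; first by exists (inl (inr j)).
  have [Bc|[i _ ic]] := hB k c E; last by exists (inl (inl i)); split=> // v /=.
  by exists (inr c); split=> // d [<-].
exists (fun v => sat f (asgn h' v)); split.
  by exists N, f, h'; split=> // k c; exact: (h'P k).1.
move=> v; rewrite hP; suff -> : asgn h v = asgn h' (sum_asgn a v) by [].
by apply/funext => k; rewrite (h'P k).2.
Qed.

End DefinabilityMore.

Section Mutual.
Context {L : language} {T : theory L} (C : monster T).
Variables (A : set C) (K : Type) (m : K -> nat) (I : forall i, sequence C (m i)).
Hypothesis Imut : mutually_indiscernible A I.

Definition posvar := {i : K & (nat * 'I_(m i))%type}.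

Definition rows_at (e : forall i, nat -> sidx (I i)) : posvar -> C :=
  fun q => I (projT1 q) (e (projT1 q) (projT2 q).1) (projT2 q).2.

Definition increasing_below (R : K -> nat) (e : forall i, nat -> sidx (I i)) :=
  forall i, {in gtn (R i) &, {homo e i : l l' / (l < l')%N >-> (l < l')%O}}.

Definition supported (R : K -> nat) (P : (posvar -> C) -> Prop) :=
  forall v w, (forall q, ((projT2 q).1 < R (projT1 q))%N -> v q = w q) -> P v <-> P w.

(** The entries of the other rows are parameters over which row [i] is indiscernible. *)
Lemma mutual_row (R : K -> nat) (P : (posvar -> C) -> Prop) i (e e' : forall i, nat -> sidx (I i)) :
  dfn A P -> supported R P ->
  increasing_below R e -> increasing_below R e' -> (forall j, j <> i -> e j = e' j) ->
  P (rows_at e) -> P (rows_at e').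
Proof.
move=> dP sP ie ie' ee' Pe.
case Ri : (R i) => [|r].
  apply/(sP (rows_at e)) => // -[j [l c]] /= lR; rewrite /rows_at /= ee' // => ji.
  by move: lR; rewrite ji Ri.
(* Positions from [R i] on are clipped to [r]; by [supported], [P] does not depend on them. *)
pose h (q : posvar) : ('I_r.+1 * 'I_(m i)) + C := match pselect (projT1 q = i) with
  | left E => inl (inord (minn (projT2 q).1 r),
                   eq_rect (projT1 q) (fun z => 'I_(m z)) (projT2 q).2 i E)
  | right _ => inr (rows_at e' q) end.
have hB q c : h q = inr c ->
    (A `|` \bigcup_(j in [set j | j <> i]) elements (I j)) c.
  rewrite /h; case: pselect => // qi [<-]; right.
  exists (projT1 q) => //; exists (e' (projT1 q) (projT2 q).1); by exists (projT2 q).2.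
have dB : dfn (A `|` \bigcup_(j in [set j | j <> i]) elements (I j)) P.
  by apply: dfn_subset dP; left.
have hrow e0 : (forall j, j <> i -> e0 j = e' j) ->
    P (rows_at e0) <-> P (fun q => match h q with
      inl u => I i (e0 i u.1) u.2 | inr c => c end).
  move=> e0e; apply: sP => -[j [l c]] /= lR; rewrite /h; case: pselect => /= ji.
    case: i / ji Ri {hB dB ie ie' e0e ee' h} => /= Rj.
    move: lR; rewrite Rj ltnS => lr.
    by rewrite /rows_at /= (minn_idPl lr) inordK.
  by rewrite /rows_at /= e0e.
have inc e0 : increasing_below R e0 ->
    {homo (fun u : 'I_r.+1 => e0 i u) : u v / (u < v)%N >-> (u < v)%O}.
  by move=> ie0 u v uv; apply: ie0; rewrite ?inE ?Ri.
move: Pe; rewrite hrow // [X in _ -> X]hrow // => Pe.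
have /same_typeP/(_ _ (dfn_subst hB dB)) := Imut (inc _ ie) (inc _ ie').
by move=> [+ _]; apply.
Qed.

(** Only finitely many rows meet the support of [P]; they are exchanged one at a time. *)
Lemma mutual_rows (R : K -> nat) (P : (posvar -> C) -> Prop)
    (e e' : forall i, nat -> sidx (I i)) :
  dfn A P -> supported R P ->
  increasing_below R e -> increasing_below R e' -> P (rows_at e) -> P (rows_at e').
Proof.
move=> dP sP ie ie' Pe; have [js jsP] := dfn_support dP.
pose hyb (is_ : seq K) i := if pselect (List.In i is_) then e' i else e i.
have ihyb is_ : increasing_below R (hyb is_).
  by move=> i; rewrite /hyb; case: pselect => _ /=; [exact: ie'|exact: ie].
have {}Pe : P (rows_at (hyb (map (@projT1 _ _) js))).
  elim: (map _ _) => [|i is_ IH].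
    suff -> : hyb [::] = e by []; apply: functional_extensionality_dep => i.
    by rewrite /hyb; case: pselect.
  apply: (mutual_row (i := i) dP sP (ihyb is_)) IH => // j ji.
  rewrite /hyb; case: pselect => jis /=; case: pselect => // H; first by case: H; right.
  by case: H => // ij; case: ji.
apply/(jsP (rows_at (hyb (map (@projT1 _ _) js)))) => // q qjs.
rewrite /rows_at /hyb; case: pselect => // H; case: H.
exact: List.in_map.
Qed.

End Mutual.

Lemma dep_choice (K : Type) (X : K -> Type) (R : forall i, X i -> Prop) :
  (forall i, exists x, R i x) -> exists f : forall i, X i, forall i, R i (f i).
Proof. by move=> H; exists (fun i => projT1 (cid (H i))) => i; exact: projT2 (cid (H i)). Qed.

Lemma nat_pigeonhole (Q : nat -> Prop) : exists h : nat -> nat,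
  {homo h : i j / (i < j)%N} /\ ((forall l, Q (h l)) \/ forall l, ~ Q (h l)).
Proof.
suff key (R : nat -> Prop) : (forall N, exists2 l, (N <= l)%N & R l) ->
    exists h : nat -> nat, {homo h : i j / (i < j)%N} /\ forall l, R (h l).
  have [/key[h [hinc hQ]]|/existsNP[N HN]] :=
    pselect (forall N, exists2 l, (N <= l)%N & Q l); first by exists h; split=> //; left.
  exists (addn N); split=> [i j|]; first by rewrite ltn_add2l.
  by right=> l Ql; apply: HN; exists (N + l)%N => //; exact: leq_addr.
move=> H; have /choice[g gP] : forall N, exists l, (N <= l)%N /\ R l.
  by move=> N; have [l] := H N; exists l.
pose h := fix h n := match n with 0 => g 0 | n'.+1 => g (h n').+1 end.
exists h; split; last by case=> [|n] /=; exact: (gP _).2.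
apply: homo_ltn; first exact: ltn_trans.
by move=> i /=; exact: (gP _).1.
Qed.

(** * Ehrenfeucht-Mostowski rows and their reindexings *)

Section ReindexRows.
Context {L : language} {T : theory L} (C : monster T).
Variables (A : set C) (K : Type) (m : K -> nat) (I : forall i, sequence C (m i)).
Hypothesis Imut : mutually_indiscernible A I.

(* Rows indexed by nat with the Ehrenfeucht-Mostowski type of the rows I. *)
Definition em_rows (w : posvar m -> C) := forall (Q : (posvar m -> C) -> Prop) R e,
  dfn A Q -> supported R Q -> increasing_below (I := I) R e -> Q (rows_at e) -> Q w.

Lemma exists_increasing_below (R : K -> nat) : exists e, increasing_below (I := I) R e.
Proof.
by have [e ie] := dep_choice (fun i => infinite_inc (@sidx_infinite _ _ (I i)) (R i)); exists e.
Qed.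

Lemma increasing_below_le (R R' : K -> nat) e :
  (forall i, R i <= R' i)%N -> increasing_below (I := I) R' e -> increasing_below R e.
Proof.
move=> RR ie i l l'; rewrite !inE => lR lR'.
by apply: ie; rewrite inE; [exact: leq_trans (RR i)|exact: leq_trans (RR i)].
Qed.

Lemma dfn_supported (Q : (posvar m -> C) -> Prop) : dfn A Q -> exists R, supported R Q.
Proof.
move=> /dfn_support[js jsP].
exists (fun=> sumn (map (fun q => (projT2 q).1.+1) js)) => v w vw.
apply: jsP => q qjs; apply: vw.
elim: js qjs => //= q' js IH [->|/IH qjs]; first exact: leq_addr.
exact: leq_trans (leq_addl _ _).
Qed.

Definition shift_rows (d : K -> nat -> nat) (q : posvar m) : posvar m :=
  existT _ (projT1 q) (d (projT1 q) (projT2 q).1, (projT2 q).2).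

Lemma em_rows_reindex w d : em_rows w ->
  (forall i, {homo d i : l l' / (l < l')%N}) -> em_rows (w \o shift_rows d).
Proof.
move=> emw dinc Q R e dQ sQ ie Qe.
have [e' ie'] := exists_increasing_below (fun i => d i (R i)).
have dm := fun i => ltnW_homo (dinc i).
apply: (emw (fun v => Q (v \o shift_rows d)) (fun i => d i (R i)) e').
- exact: dfn_comp.
- move=> v v' vv'; apply: sQ => -[i [l c]] /= lR.
  by rewrite vv' //=; exact: dinc.
- by [].
apply: (mutual_rows Imut dQ sQ ie (e' := fun i l => e' i (d i l))) Qe.
move=> i l l'; rewrite !inE => lR lR' ll'.
by apply: ie'; rewrite ?inE; [exact: dinc|exact: dinc|exact: dinc].
Qed.

Lemma em_rows_transfer w w' (Q : (posvar m -> C) -> Prop) :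
  em_rows w -> em_rows w' -> dfn A Q -> Q w -> Q w'.
Proof.
move=> emw emw' dQ Qw; have [R sQ] := dfn_supported dQ.
have [e ie] := exists_increasing_below R.
apply: (emw' Q R e dQ sQ ie); apply: contrapT => nQ.
apply: (emw (fun v => ~ Q v) R e) Qw => //; first exact: dfn_not.
by move=> v v' vv'; rewrite (sQ _ _ vv').
Qed.

Lemma smallT_posvar : smallT C K -> smallT C (posvar m).
Proof.
move=> sK; apply: (@smallT_inj _ _ _ _ (K * (nat * nat))%type
  (fun q => (projT1 q, ((projT2 q).1, val (projT2 q).2)))).
  by move=> [i [l c]] [i' [l' c']] /= [ii]; case: i' / ii c' => c' -> /val_inj ->.
by apply: smallT_prod => //; exact: smallT_count.
Qed.

(** [w] and its reindexing have the same type over [A], so [a] has a counterpart beside the latter,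
    as in homogeneity over [A]. *)
Lemma transport_tuple n (a : 'I_n -> C) w d (q0 : posvar m) : small C A -> smallT C K ->
  em_rows w -> (forall i, {homo d i : l l' / (l < l')%N}) ->
  exists a' : 'I_n -> C, forall P : ('I_n + posvar m -> C) -> Prop, dfn A P ->
    P (sum_asgn a w) -> P (sum_asgn a' (w \o shift_rows d)).
Proof.
move=> sA sK emw dinc; have emw' := em_rows_reindex emw dinc.
pose w' := w \o shift_rows d.
pose Gamma : set (('I_n -> C) -> Prop) := [set G | exists2 P : ('I_n + posvar m -> C) -> Prop,
  dfn A P /\ P (sum_asgn a w) & G = fun x => P (sum_asgn x w')].
have swap : forall P : ('I_n + posvar m -> C) -> Prop, dfn A P ->
    dfn A (fun v : posvar m + 'I_n -> C => P (sum_asgn (v \o inr) (v \o inl))).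
  move=> P dP; apply: dfn_ext (dfn_comp (fun u => match u with
    inl x => inr x | inr y => inl y end) dP) => v.
  by suff -> : sum_asgn (v \o inr) (v \o inl) = v \o (fun u => match u with
    inl x => inr x | inr y => inl y end) by []; apply/funext => -[].
have [||||a' a'P] := @compactness _ _ C 'I_n (A `|` range w') Gamma.
- exact: smallT_count.
- by apply: smallU => //; apply: (small_range (smallT_posvar sK) (f := w')).
- move=> _ [P [dP _] ->].
  have sB (u : 'I_n + posvar m) c : (match u with inl x => inl x | inr q => inr (w' q) end :
    'I_n + C) = inr c -> (A `|` range w') c.
    by case: u => // q [<-]; right; exists q.
  apply: dfn_ext (dfn_subst sB (dfn_subset (@subsetUl _ A (range w')) dP)) => x.
  by set y := (X in P X); suff -> : y = sum_asgn x w' by []; apply/funext => -[].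
- move=> Gs GsG.
  have [Ps [Ps1 Ps2]] := list_choice (R := fun G (P : ('I_n + posvar m -> C) -> Prop) =>
    (dfn A P /\ P (sum_asgn a w)) /\ G = fun x => P (sum_asgn x w'))
    (fun G GGs => let: ex_intro2 P h1 h2 := GsG G GGs in ex_intro _ P (conj h1 h2)).
  have dPs := dfn_existsW q0 (swap _ (dfn_conj (fun P PPs => let: ex_intro2 G _ h :=
    Ps1 P PPs in h.1.1))).
  have [|x xP] := em_rows_transfer emw emw' dPs.
    exists a => P PPs; have [G _ [[_ Pa] _]] := Ps1 P PPs.
    by rewrite (_ : sum_asgn _ _ = sum_asgn a w)//; apply/funext => -[].
  exists x => G /Ps2[P PPs [_ ->]]; have := xP P PPs.
  by rewrite (_ : sum_asgn _ _ = sum_asgn x w')//; apply/funext => -[].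
exists a' => P dP Pa; apply: (a'P (fun x => P (sum_asgn x w'))).
by exists P.
Qed.

End ReindexRows.

(** * Patterns from failures of indiscernibility *)

Lemma sum_asgn_swap L (M : structure L) X W (v : X -> M) (w : W -> M) :
  sum_asgn w v \o (fun u => match u with inl j => inr j | inr q => inl q end) = sum_asgn v w.
Proof. by apply/funext => -[]. Qed.

Section Pattern.
Context {L : language} {T : theory L} (C : monster T).
Variables (A : set C) (K : Type) (n : nat).

(* Witness that the row I is not indiscernible over A and a: the positions ss
   and st in the finite increasing family rz, and the formula rP. *)
Record row_witness m (I : sequence C m) := RowWitness {
  rk : nat;
  rr : nat;
  ss : 'I_rk -> nat;
  st : 'I_rk -> nat;
  rz : nat -> sidx I;
  rP : ('I_n + ('I_rk * 'I_m) -> C) -> Prop }.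

Arguments rk {m I} r.
Arguments rr {m I} r.
Arguments ss {m I} r _.
Arguments st {m I} r _.
Arguments rz {m I} r _.
Arguments rP {m I} r _.

Definition block m k (i : K) (f : 'I_k -> nat) (w : posvar m -> C) : 'I_k * 'I_(m i) -> C :=
  fun q => w (existT _ i (f q.1, q.2)).

Lemma not_indiscernible_witness (a : 'I_n -> C) m (I : sequence C m) :
  ~ indiscernible (A `|` range a) I ->
  exists x : row_witness I, [/\ dfn A (rP x),
    {in gtn (rr x) &, {homo rz x : l l' / (l < l')%N >-> (l < l')%O}},
    (forall j, ss x j < rr x /\ st x j < rr x)%N,
    {homo ss x : i j / (i < j)%N} /\ {homo st x : i j / (i < j)%N} &
    rP x (sum_asgn a (fun q => I (rz x (ss x q.1)) q.2)) /\
    ~ rP x (sum_asgn a (fun q => I (rz x (st x q.1)) q.2))].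
Proof.
move=> nI.
have [k [s [t [sinc tinc [P [dP [Ps Pt]]]]]]] : exists k (s t : 'I_k -> sidx I),
    [/\ {homo s : i j / (i < j)%N >-> (i < j)%O},
        {homo t : i j / (i < j)%N >-> (i < j)%O} &
        exists P : ('I_k * 'I_m -> C) -> Prop, dfn (A `|` range a) P /\
        P (fun q => I (s q.1) q.2) /\ ~ P (fun q => I (t q.1) q.2)].
  apply: contrapT => H; apply: nI => k s t sinc tinc; apply/same_typeP => P dP.
  split=> [Ps|Pt]; apply: contrapT => nP; apply: H.
    by exists k, s, t; split=> //; exists P.
  by exists k, t, s; split=> //; exists P.
have [P' [dP' P'P]] := dfn_range dP.
have [r [z [_ [g [zinc _ gz _]]]]] := @enum_order (bool * 'I_k)%type _ _ _ _
  (fun u => if u.1 then s u.2 else t u.2) (fun u => if u.1 then s u.2 else t u.2)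
  (fun _ _ => erefl).
have [o0 _] : exists o : sidx I, True.
  by have [o _] := infinite_setN0 (@sidx_infinite _ _ I); exists o.
pose rz0 l := if insub l is Some l' then z l' else o0.
have rz0E (l : 'I_r) : rz0 l = z l by rewrite /rz0 valK.
have zlt (u v : 'I_r) : (z u < z v)%O -> (u < v)%N.
  move=> uv; rewrite ltnNge leq_eqVlt; apply/negP => /orP[/eqP/val_inj E|/zinc vu].
    by rewrite E ltxx in uv.
  by have := lt_trans uv vu; rewrite ltxx.
exists (@RowWitness m I k r (fun j => g (true, j)) (fun j => g (false, j)) rz0 P').
split=> //=.
- move=> l l'; rewrite !inE => lr lr' ll'.
  by rewrite (rz0E (Ordinal lr)) (rz0E (Ordinal lr')); exact: zinc.
- by split=> i j ij; apply: zlt; rewrite -!gz /=; [exact: sinc|exact: tinc].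
- rewrite -!P'P; split.
    by rewrite (_ : (fun _ => _) = fun q => I (s q.1) q.2)//; apply/funext => q; rewrite rz0E -gz.
  by rewrite (_ : (fun _ => _) = fun q => I (t q.1) q.2)//; apply/funext => q; rewrite rz0E -gz.
Qed.

Variables (m : K -> nat) (I : forall i, sequence C (m i)).
Hypothesis Imut : mutually_indiscernible A I.
Hypotheses (sA : small C A) (sK : smallT C K).
Variables (p : set (pformula C n)) (a : 'I_n -> C).
Hypotheses (pA : forall f, p f -> params_in A f) (ap : realizes a p).
Hypothesis nI : forall i, ~ indiscernible (A `|` range a) (I i).
Hypothesis q0 : posvar m.

(** The sequences in [I] only provide finite increasing stretches. They are replaced by rows indexed
    by [nat] of the same type, together with a new tuple that breaks these rows at the same
    positions as [a] broke the old ones. *)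
Lemma em_rows_pattern : exists (x : forall i, row_witness (I i)) (w : posvar m -> C) (a1 : 'I_n -> C),
  [/\ em_rows A I w, realizes a1 p,
   forall i, dfn A (rP (x i)),
   forall i, [/\ forall j, (ss (x i) j < rr (x i))%N /\ (st (x i) j < rr (x i))%N,
     {homo ss (x i) : i j / (i < j)%N} & {homo st (x i) : i j / (i < j)%N}] &
   forall i, rP (x i) (sum_asgn a1 (block (ss (x i)) w)) /\
     ~ rP (x i) (sum_asgn a1 (block (st (x i)) w))].
Proof.
have [x xP] := dep_choice (fun i => not_indiscernible_witness (@nI i)).
pose G1 : set (('I_n + posvar m -> C) -> Prop) :=
  [set G | exists2 f, p f & G = fun v => holds (v \o inl) f].
pose G3 : set (('I_n + posvar m -> C) -> Prop) :=
  [set G | exists i, G = fun v => rP (x i) (sum_asgn (v \o inl) (block (ss (x i)) (v \o inr))) /\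
     ~ rP (x i) (sum_asgn (v \o inl) (block (st (x i)) (v \o inr)))].
pose em Q R := [/\ dfn A Q, supported R Q &
  exists e, increasing_below (I := I) R e /\ Q (rows_at e)].
pose G2 : set (('I_n + posvar m -> C) -> Prop) :=
  [set G | exists Q R, em Q R /\ G = fun v => Q (v \o inr)].
have dG13 G : (G1 `|` G3) G -> dfn A G.
  move=> [[f pf ->]|[i ->]]; first exact: dfn_holds (pA pf).
  have [dP _ _ _ _] := xP i.
  have E f : (fun v : 'I_n + posvar m -> C => rP (x i) (sum_asgn (v \o inl) (block f (v \o inr)))) =
     (fun v => rP (x i) (v \o (fun u => match u with inl j => inl j
        | inr q => inr (existT _ i (f q.1, q.2)) end))).
    by apply/funext => v; congr rP; apply/funext => -[].
  by apply: dfn_and; [|apply: dfn_not]; rewrite E; apply: dfn_comp.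
have [||||v vP] := @compactness _ _ C ('I_n + posvar m) A (G1 `|` G3 `|` G2).
- by apply: smallT_sum; [exact: smallT_count|exact: smallT_posvar].
- exact: sA.
- move=> G [/dG13 //|[Q [R [[dQ _ _] ->]]]].
  exact: (dfn_comp inr dQ).
- move=> Gs GsG.
  have [Rs [_ RsP]] := list_choice (R := fun G R => G2 G -> exists Q,
      em Q R /\ G = fun v => Q (v \o inr)) (s := Gs)
    (fun G _ => match pselect (G2 G) with
      | left (ex_intro Q (ex_intro R h)) => ex_intro _ R (fun _ => ex_intro _ Q h)
      | right nG => ex_intro _ (fun=> 0) (fun g => False_ind _ (nG g)) end).
  (* Long enough for the witnesses and for all the conditions from [G2] in the list. *)
  pose R i := (rr (x i) + sumn (map (fun R : K -> nat => R i) Rs))%N.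
  have [e ie] := exists_increasing_below I R.
  pose Gs13 := seq.filter (fun G => `[< (G1 `|` G3) G >]) Gs.
  have Gs13P G : List.In G Gs13 <-> List.In G Gs /\ (G1 `|` G3) G.
    rewrite /Gs13; elim: Gs {GsG RsP Gs13} => [|G' Gs' IH] /=; first by split=> // -[].
    case: asboolP => G'13 /=; rewrite IH; split.
    - by move=> [<-|[]]; split=> //; [left|right].
    - by move=> [[<-|]]; [left|right].
    - by move=> [] ? ?; split=> //; right.
    - by move=> [[<-|//]].
  (* [mutual_rows] moves conditions on the rows alone, so the tuple is quantified away; a new one is
     read off after the move. *)
  pose Q (w : posvar m -> C) := exists y, forall G, List.In G Gs13 -> G (sum_asgn y w).
  have dQ : dfn A Q.
    have := dfn_existsW q0 (dfn_comp (fun u : 'I_n + posvar m => match u with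
      inl j => inr j | inr q => inl q end)
      (dfn_conj (fun G GGs => dG13 G ((Gs13P G).1 GGs).2))).
    apply: dfn_ext => w; rewrite /Q.
    by split=> -[y yP]; exists y => G /yP; rewrite /= sum_asgn_swap.
  have sQ : supported (fun i => rr (x i)) Q.
    suff sup v v' : (forall q, ((projT2 q).1 < rr (x (projT1 q)))%N -> v q = v' q) -> Q v -> Q v'.
      by move=> v v' vv'; split; apply: sup => // q lq; rewrite vv'.
    move=> vv' [y yP]; exists y => G /[dup] /yP Gv /Gs13P[_ [[f pf E]|[i E]]].
      by move: Gv; rewrite E.
    move: Gv; rewrite E; have [_ _ lt_rr _ _] := xP i.
    rewrite (_ : block _ (_ \o inr) = block (ss (x i)) v'); last first.
      by apply/funext => q; rewrite /block /= vv' //=; exact: (lt_rr _).1.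
    rewrite (_ : block _ (_ \o inr) = block (st (x i)) v'); last first.
      by apply/funext => q; rewrite /block /= vv' //=; exact: (lt_rr _).2.
    by [].
  have Qz : Q (rows_at (fun i => rz (x i))).
    exists a => G /Gs13P[_ [[f pf ->]|[i ->]]]; first exact: ap.
    by have [_ _ _ _] := xP i.
  have iz : increasing_below (fun i => rr (x i)) (fun i => rz (x i)).
    by move=> i; have [] := xP i.
  have [|y yP] := mutual_rows Imut dQ sQ iz _ Qz (e' := e).
    by apply: increasing_below_le ie => i; exact: leq_addr.
  exists (sum_asgn y (rows_at e)) => G GGs.
  have [G13|G2G] := GsG G GGs; first by apply: yP; apply/Gs13P.
  have [R' R'Rs /(_ G2G)[Q' [[dQ' sQ' [e' [ie' Q'e']]] ->]]] := RsP G GGs.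
  apply: (mutual_rows Imut dQ' sQ' ie' _ Q'e').
  apply: increasing_below_le ie => i; apply: leq_trans (leq_addl _ _).
  elim: Rs R'Rs {RsP R} => //= R1 Rs IH [->|/IH H]; first exact: leq_addr.
  exact: leq_trans (leq_addl _ _).
exists x, (v \o inr), (v \o inl); split.
- move=> Q R e dQ sQ ie Qe; apply: (vP (fun v => Q (v \o inr))).
  by right; exists Q, R; split=> //; split=> //; exists e.
- by move=> f pf; apply: (vP (fun v => holds (v \o inl) f)); left; left; exists f.
- by move=> i; have [] := xP i.
- by move=> i; have [_ _ ? [? ?] _] := xP i.
- by move=> i; apply: (vP (fun v => rP (x i) (sum_asgn (v \o inl) (block (ss (x i)) (v \o inr))) /\
     ~ rP (x i) (sum_asgn (v \o inl) (block (st (x i)) (v \o inr)))));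
     left; right; exists i.
Qed.
End Pattern.

Arguments rk {L T C n m I} r.
Arguments rr {L T C n m I} r.
Arguments ss {L T C n m I} r _.
Arguments st {L T C n m I} r _.
Arguments rz {L T C n m I} r _.
Arguments rP {L T C n m I} r _.

Lemma digits_homo k (b : nat -> 'I_k.+1 -> nat) :
  (forall l, {homo b l : i j / (i < j)%N}) ->
  (forall l l' i j, (l < l')%N -> (b l i < b l' j)%N) ->
  {homo (fun y => b (y %/ k.+1) (inord (y %% k.+1))) : y y' / (y < y')%N}.
Proof.
move=> b1 b2 y y' yy'; have := leq_div2r k.+1 (ltnW yy').
rewrite leq_eqVlt => /orP[/eqP E|]; last exact: b2.
rewrite -E; apply: b1; rewrite !inordK ?ltn_pmod //.
by move: yy'; rewrite {1}(divn_eq y k.+1) {1}(divn_eq y' k.+1) E ltn_add2l.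
Qed.

(** * Independent patterns of blocks *)

Section ICT.
Context {L : language} {T : theory L} (C : monster T).
Variables (A : set C) (K : Type) (n : nat).
Variables (m : K -> nat) (I : forall i, sequence C (m i)).
Hypothesis Imut : mutually_indiscernible A I.
Hypotheses (sA : small C A) (sK : smallT C K).
Variables (p : set (pformula C n)) (a : 'I_n -> C).
Hypotheses (pA : forall f, p f -> params_in A f) (ap : realizes a p).
Hypothesis nI : forall i, ~ indiscernible (A `|` range a) (I i).
Hypothesis q0 : posvar m.

Record pattern_data i := PatternData {
  pk : nat;
  pd : nat -> nat;
  pP : ('I_n + ('I_pk.+1 * 'I_(m i)) -> C) -> Prop }.
Arguments pk {i} _.
Arguments pd {i} _ _.
Arguments pP {i} _ _.

(** By the pigeonhole principle [P] has one truth value on infinitely many blocks beyond both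
    witness blocks. One of the witness blocks has the other value; it is put in front as block 0,
    and [P] is negated if necessary. *)
Lemma exists_pattern_data (x : forall i, row_witness n (I i)) (w : posvar m -> C) (a1 : 'I_n -> C) i :
  dfn A (rP (x i)) ->
  [/\ forall j, (ss (x i) j < rr (x i))%N /\ (st (x i) j < rr (x i))%N,
     {homo ss (x i) : i j / (i < j)%N} & {homo st (x i) : i j / (i < j)%N}] ->
  rP (x i) (sum_asgn a1 (block (ss (x i)) w)) /\
     ~ rP (x i) (sum_asgn a1 (block (st (x i)) w)) ->
  exists d : pattern_data i, [/\ dfn A (pP d), {homo pd d : l l' / (l < l')%N} &
    forall l, pP d (sum_asgn a1 (block (fun j : 'I_(pk d).+1 => pd d (l * (pk d).+1 + j)) w))
      <-> l = 0].
Proof.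
case: (x i) => -[|k] r s t z P /= dP [lt_r sinc tinc] [Ps Pt].
  case: Pt; rewrite (_ : block t w = block s w)//.
  by apply/funext => -[[]].
pose g l (j : 'I_k.+1) := (r + k.+1 * l + j)%N.
have [h [hinc hQ]] := nat_pigeonhole (fun l => P (sum_asgn a1 (block (g l) w))).
have [s0 [P0 [dP0 [s0r s0inc [P0s P0h]]]]] : exists (s0 : 'I_k.+1 -> nat)
    (P0 : ('I_n + ('I_k.+1 * 'I_(m i)) -> C) -> Prop), dfn A P0 /\
   [/\ forall j, (s0 j < r)%N, {homo s0 : i j / (i < j)%N} &
   P0 (sum_asgn a1 (block s0 w)) /\ forall l, ~ P0 (sum_asgn a1 (block (g (h l)) w))].
  case: hQ => hQ.
    exists t, (fun v => ~ P v); split; first exact: dfn_not.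
    by split=> // [j|]; [exact: (lt_r j).2|split=> // l; apply].
  by exists s, P; split=> //; split=> // j; exact: (lt_r j).1.
pose b l j := if l is l'.+1 then g (h l') j else s0 j.
exists (@PatternData i k (fun y => b (y %/ k.+1) (inord (y %% k.+1))) P0); split=> //=.
  apply: digits_homo => [[//|l] u v uv|[|l] [//|l'] u v ll'] /=.
  - by rewrite /g ltn_add2l.
  - by apply: leq_trans (s0r u) _; rewrite /g; lia.
  - by have := hinc l l' ll'; have := ltn_ord u; rewrite /g; nia.
move=> l; rewrite (_ : block _ w = block (b l) w); last first.
  apply/funext => q; rewrite /block divnMDl // divn_small // addn0.
  by rewrite modnMDl modn_small // inord_val.
by case: l => [|l]; split=> // /P0h.
Qed.

(** [y eta] sees the rows from block [eta i] on as [a1] sees them from block 0. Nothing is known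
    about earlier blocks, hence the restriction to [eta i < q]. *)
Lemma ict_pattern : exists (W : K -> finType) (phi : forall i, ('I_n + W i -> C) -> Prop)
    (b : forall i, nat -> W i -> C) (y : (K -> nat) -> 'I_n -> C),
  [/\ forall i, dfn A (phi i), forall eta, realizes (y eta) p,
      forall eta i, phi i (sum_asgn (y eta) (b i (eta i))) &
      forall eta i q, (eta i < q)%N -> ~ phi i (sum_asgn (y eta) (b i q))].
Proof.
have [x [w [a1 [emw a1p xA xlt xP]]]] := em_rows_pattern Imut sA sK pA ap nI q0.
have [d dP] := dep_choice (fun i => exists_pattern_data (xA i) (xlt i) (xP i)).
pose k i := (pk (d i)).+1.
pose w2 := w \o shift_rows (fun i => pd (d i)).
have emw2 : em_rows A I w2 by apply: em_rows_reindex => // i; have [] := dP i.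
pose blk i l : 'I_(k i) -> nat := fun j => (l * k i + j)%N.
have w2P i l : pP (d i) (sum_asgn a1 (block (blk i l) w2)) <-> l = 0.
  by have [_ _ /(_ l)] := dP i.
have /choice[y yP] : forall eta : K -> nat, exists a' : 'I_n -> C,
    forall P : ('I_n + posvar m -> C) -> Prop, dfn A P ->
    P (sum_asgn a1 w2) -> P (sum_asgn a' (w2 \o shift_rows (fun i l => (eta i * k i + l)%N))).
  move=> eta; apply: (transport_tuple Imut) => // i l l' ll'.
  by rewrite ltn_add2l.
have dblk i l : dfn A (fun v : 'I_n + posvar m -> C =>
    pP (d i) (sum_asgn (v \o inl) (block (blk i l) (v \o inr)))).
  have [dd _ _] := dP i.
  apply: dfn_ext (dfn_comp (fun u => match u with inl j => inl j
    | inr q => inr (existT (fun i => (nat * 'I_(m i))%type) i (blk i l q.1, q.2)) end) dd) => v.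
  set u := (X in pP _ X); suff -> : u = sum_asgn (v \o inl) (block (blk i l) (v \o inr)) by [].
  by rewrite /u; apply/funext => -[].
have blkE eta i l : block (i := i) (blk i l) (w2 \o shift_rows (fun i l => (eta i * k i + l)%N)) =
    block (i := i) (blk i (eta i + l)) w2.
  apply/funext => -[j c]; rewrite /block /= /shift_rows /blk /=.
  by rewrite mulnDl addnA.
exists (fun i => ('I_(k i) * 'I_(m i))%type : finType), (fun i => pP (d i)).
exists (fun i l => block (i := i) (blk i l) w2), y; split.
- by move=> i; have [] := dP i.
- move=> eta f pf.
  apply: (yP eta (fun v => holds (v \o inl) f)); last exact: a1p.
  exact: dfn_holds (pA pf).
- move=> eta i; have := yP eta _ (dblk i 0).
  by rewrite /= blkE addn0; apply; apply/w2P.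
- move=> eta i q etaq; have := yP eta _ (dfn_not (dblk i (q - eta i))).
  rewrite /= blkE subnKC; last exact: ltnW.
  by apply; move=> /w2P; lia.
Qed.

End ICT.

(** * Families depending only on order types *)

Lemma nat_ultrafilter : exists U : (nat -> Prop) -> Prop,
  [/\ forall P Q : nat -> Prop, (forall n, P n -> Q n) -> U P -> U Q,
      forall P Q : nat -> Prop, U P -> U Q -> U (fun n => P n /\ Q n),
      forall P : nat -> Prop, U (fun n => ~ P n) <-> ~ U P &
      forall N, U (fun n => (N <= n)%N)].
Proof.
pose F : set_system nat := [set A | exists N, forall n, (N <= n)%N -> A n].
have FF : ProperFilter F.
  apply: Build_ProperFilter_ex; first by move=> B [N NB]; exists N; exact: NB.
  split; first by exists 0.
    move=> B D [N NB] [N' ND]; exists (maxn N N') => n; rewrite geq_max => /andP[? ?].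
    by split; [exact: NB|exact: ND].
  by move=> B D BD [N NB]; exists N => n /NB /BD.
have [U [UU FU]] := ultraFilterLemma FF.
exists U; split=> [P Q PQ|P Q|P|N].
- by apply: filterS => n; exact: PQ.
- exact: filterI.
- split=> [nP UP|nUP]; first by have [n []] := filter_ex (filterI nP UP).
  by have [|//] := in_ultra_setVsetC P UU.
- by apply: FU; exists N.
Qed.

(** * Iterated limits along an ultrafilter *)

Section IteratedLimit.
Variable U : (nat -> Prop) -> Prop.
Hypothesis U_mono : forall P Q : nat -> Prop, (forall n, P n -> Q n) -> U P -> U Q.
Hypothesis U_and : forall P Q : nat -> Prop, U P -> U Q -> U (fun n => P n /\ Q n).
Hypothesis U_not : forall P : nat -> Prop, U (fun n => ~ P n) <-> ~ U P.
Hypothesis U_tail : forall N, U (fun n => (N <= n)%N).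

Definition updn (g : rat -> nat) s x : rat -> nat := fun t => if t == s then x else g t.

(* Iterated ultrafilter quantifier: U x_1 ... U x_k, Q (g with s_j set to x_j). *)
Fixpoint ulim (S : seq rat) (Q : (rat -> nat) -> Prop) (g : rat -> nat) : Prop :=
  match S with
  | [::] => Q g
  | s :: S' => U (fun x => ulim S' Q (updn g s x))
  end.

Lemma U_iff (P Q : nat -> Prop) : (forall n, P n <-> Q n) -> U P <-> U Q.
Proof. by move=> PQ; split; apply: U_mono => n /PQ. Qed.

Lemma U_true : U (fun=> True).
Proof. by apply: U_mono (U_tail 0). Qed.

Lemma U_const (P : Prop) : U (fun=> P) <-> P.
Proof.
split=> [UP|p]; last by apply: U_mono U_true.
apply: contrapT => nP; have : U (fun=> False) by apply: U_mono UP.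
exact: (U_not (fun=> False)).1 (@U_mono (fun=> True) (fun=> ~ False) (fun _ _ f => f) U_true).
Qed.

Lemma ulim_mono S (Q Q' : (rat -> nat) -> Prop) g :
  (forall g, Q g -> Q' g) -> ulim S Q g -> ulim S Q' g.
Proof.
by move=> QQ; elim: S g => [|s S IH] g /=; [exact: QQ|apply: U_mono => x; exact: IH].
Qed.

Lemma ulim_and S (Q Q' : (rat -> nat) -> Prop) g :
  ulim S Q g -> ulim S Q' g -> ulim S (fun g => Q g /\ Q' g) g.
Proof.
elim: S g => [|s S IH] g //= UQ UQ'.
by apply: U_mono (U_and UQ UQ') => x [? ?]; exact: IH.
Qed.

Lemma ulim_not S (Q : (rat -> nat) -> Prop) g :
  ulim S (fun g => ~ Q g) g <-> ~ ulim S Q g.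
Proof. by elim: S g => [|s S IH] g //=; rewrite -U_not; apply: U_iff. Qed.

Lemma ulim_ex S (Q : (rat -> nat) -> Prop) g : ulim S Q g -> exists g', Q g'.
Proof.
elim: S g => [|s S IH] g /=; first by exists g.
move=> UQ; apply: contrapT => nQ.
have : U (fun=> False) by apply: U_mono UQ => x /IH.
by move/U_const.
Qed.

Lemma ulim_irrelevant (X : pred rat) S (Q : (rat -> nat) -> Prop) g g' :
  (forall g g', {in X, g =1 g'} -> Q g <-> Q g') -> {in X, g =1 g'} ->
  ulim S Q g <-> ulim S Q g'.
Proof.
move=> QX; elim: S g g' => [|s S IH] g g' gg' /=; first exact: QX.
apply: U_iff => x; apply: IH => t tX; rewrite /updn; case: ifP => // _; exact: gg'.
Qed.

(** This puts the limits that belong to different conditions over one common list of variables,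
    where [ulim_and] applies. *)
Lemma ulim_filter (X : pred rat) S (Q : (rat -> nat) -> Prop) g :
  (forall g g', {in X, g =1 g'} -> Q g <-> Q g') ->
  ulim S Q g <-> ulim (seq.filter X S) Q g.
Proof.
move=> QX; elim: S g => [|s S IH] g //=; case: ifP => sX /=.
  by apply: U_iff => x; exact: IH.
rewrite -[X in _ <-> X]U_const; apply: U_iff => x; rewrite IH.
apply: (ulim_irrelevant _ QX) => t tX; rewrite /updn; case: eqP => // ts.
by move: tX; rewrite ts -topredE /= sX.
Qed.

(** An iterated limit only sees the order in which its variables are listed. Limit families owe
    their invariance under order isomorphisms to this. *)
Lemma ulim_map (h : rat -> rat) (S0 S : seq rat) (Q Q' : (rat -> nat) -> Prop) g g' :
  {in S0 &, injective h} -> {subset S <= S0} ->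
  (forall g g', (forall s, s \in S0 -> g s = g' (h s)) -> Q g <-> Q' g') ->
  (forall s, s \in S0 -> s \notin S -> g s = g' (h s)) ->
  ulim S Q g <-> ulim (map h S) Q' g'.
Proof.
move=> hinj + QQ'; elim: S g g' => [|s S IH] g g' SS0 gg' /=.
  by apply: QQ' => s sS0; exact: gg'.
apply: U_iff => x; apply: IH => [t tS|t tS0 tS]; first by apply: SS0; rewrite inE tS orbT.
have sS0 : s \in S0 by apply: SS0; rewrite inE eqxx.
rewrite /updn (inj_in_eq hinj) //; case: eqP => // /eqP ts; apply: gg' => //.
by rewrite inE negb_or ts.
Qed.

(** Each value is chosen after those at smaller places and hence beyond them; [N] carries this bound
    through the induction. *)
Lemma ulim_increasing S N g : sorted <%R S ->
  ulim S (fun g' => [/\ forall s, s \notin S -> g' s = g s,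
    forall s, s \in S -> (N <= g' s)%N &
    {in S &, {homo g' : s t / (s < t)%R >-> (s < t)%N}}]) g.
Proof.
elim: S N g => [|s S IH] N g //= sS.
apply: U_mono (U_tail N) => x Nx.
have {}IH := IH x.+1 (updn g s x) (path_sorted sS).
have sltS t : t \in S -> (s < t)%R.
  by move: sS; rewrite lt_path_sortedE => /andP[/allP + _]; apply.
have snS : s \notin S by apply/negP => /sltS; rewrite ltxx.
apply: ulim_mono IH => g' [g'1 g'2 g'3].
have g's : g' s = x by rewrite g'1 // /updn eqxx.
split=> [t|t|t t'].
- by rewrite inE negb_or => /andP[/negPf ts tS]; rewrite g'1 // /updn ts.
- by rewrite inE => /orP[/eqP ->|/g'2 /ltnW]; [rewrite g's|exact: leq_trans].
- rewrite !inE => /orP[/eqP ->|tS] /orP[/eqP ->|t'S]; rewrite ?ltxx ?g's //.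
  + by move=> _; exact: g'2.
  + by move=> ts; have := lt_trans ts (sltS _ tS); rewrite ltxx.
  + exact: g'3.
Qed.

End IteratedLimit.

Definition at_ M Q n I (y : Q -> 'I_n -> M) (u : I -> Q) : I * 'I_n -> M :=
  fun q => y (u q.1) q.2.

(** * Homogenization of one dimension *)

Section ExtractStep.
Local Open Scope ring_scope.
Context {L : language} {T : theory L} (C : monster T).
Variables (A : set C) (D : Type) (n : nat).
Hypotheses (sA : small C A) (sD : smallT C D).

Definition fam := (D -> rat) -> 'I_n -> C.

Definition order_in (d : D) (I : Type) (u v : I -> D -> rat) :=
  forall k l, (u k d < u l d) = (v k d < v l d).

(** Dimensions outside [F] are not yet homogeneous: there the indices themselves have to agree. In
    this form one dimension can be treated at a time. *)
Definition good_on (F : set D) (y : fam) := forall (I : finType) (u v : I -> D -> rat),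
  (forall d, F d -> order_in d u v) -> (forall d, ~ F d -> forall k, u k d = v k d) ->
  forall P : (I * 'I_n -> C) -> Prop, dfn A P -> P (at_ y u) -> P (at_ y v).

Definition setd (d : D) (g : rat -> rat) (eta : D -> rat) : D -> rat :=
  fun d' => if pselect (d' = d) then g (eta d') else eta d'.

Lemma setdE d g eta : setd d g eta d = g (eta d).
Proof. by rewrite /setd; case: pselect. Qed.

Lemma setd_neq d g eta d' : d' <> d -> setd d g eta d' = eta d'.
Proof. by rewrite /setd; case: pselect. Qed.

Definition values (d : D) (I : finType) (u : I -> D -> rat) : seq rat :=
  sort <=%R (undup [seq u k d | k <- enum I]).

Lemma mem_values d (I : finType) (u : I -> D -> rat) x :
  reflect (exists k, x = u k d) (x \in values d u).
Proof.
rewrite mem_sort mem_undup; apply: (iffP mapP) => [[k _ ->]|[k ->]]; exists k => //.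
exact: mem_enum.
Qed.

Lemma sorted_values d (I : finType) (u : I -> D -> rat) : sorted <%R (values d u).
Proof. by rewrite lt_sorted_uniq_le sort_uniq undup_uniq sort_le_sorted. Qed.

Lemma lt_sorted_sub (S S0 : seq rat) : sorted <%R S -> sorted <%R S0 ->
  {subset S0 <= S} -> seq.filter (mem S0) S = S0.
Proof.
move=> sS sS0 S0S; apply: lt_sorted_eq => //.
  by apply: sorted_filter => //; exact: lt_trans.
by move=> x; rewrite mem_filter /=; apply/andP/idP => [[]//|xS0]; split=> //; exact: S0S.
Qed.

Variables (F : set D) (d : D) (x0 : fam).
Hypothesis x0F : good_on F x0.

(** The type of a finite subfamily of [y] is the iterated limit of types in [x0], with the values in
    dimension [d] replaced in increasing order by limit variables. These types are complete by
    [ulim_not], and finitely many of them are satisfied by one choice of numbers. *)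
Lemma good_on_step : exists y : fam, good_on [set d' | d' = d \/ F d'] y /\
  forall (I : finType) (u : I -> D -> rat) (P : (I * 'I_n -> C) -> Prop), dfn A P ->
    (forall v : I -> D -> rat, order_in d u v -> (forall k, exists a, v k d = a%:R :> rat) ->
       (forall d', d' <> d -> forall k, v k d' = u k d') -> P (at_ x0 v)) ->
    P (at_ y u).
Proof.
have [U [U_mono U_and U_not U_tail]] := nat_ultrafilter.
pose sub (g : rat -> nat) : rat -> rat := fun q => (g q)%:R.
pose Q (I : finType) (u : I -> D -> rat) (P : (I * 'I_n -> C) -> Prop) (g : rat -> nat) :=
  P (at_ x0 (fun k => setd d (sub g) (u k))).
have Qloc (I : finType) (u : I -> D -> rat) P (S : seq rat) : {subset values d u <= S} ->
    forall g g', {in S, g =1 g'} -> Q I u P g <-> Q I u P g'.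
  move=> uS g g' gg'; rewrite /Q.
  suff -> : (fun k => setd d (sub g) (u k)) = (fun k => setd d (sub g') (u k)) by [].
  apply/funext => k; apply/funext => d'; rewrite /setd; case: pselect => //= dd.
  by rewrite dd /sub gg' //; apply/uS/mem_values; exists k.
pose lim (I : finType) (u : I -> D -> rat) P := ulim U (values d u) (Q I u P) (fun=> 0%N).
pose Gamma : set (((D -> rat) * 'I_n -> C) -> Prop) := [set G |
  exists (I : finType) (u : I -> D -> rat) (P : (I * 'I_n -> C) -> Prop),
  [/\ dfn A P, lim I u P & G = fun y => P (at_ (fun eta c => y (eta, c)) u)]].
have sJ : smallT C ((D -> rat) * 'I_n).
  by apply: smallT_prod; [apply: smallT_fun => //|]; exact: smallT_count.
have dat : forall (E : finType) (u : E -> D -> rat) (P : (E * 'I_n -> C) -> Prop), dfn A P ->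
    dfn A (fun y : (D -> rat) * 'I_n -> C => P (at_ (fun eta c => y (eta, c)) u)).
  by move=> E u P; exact: (dfn_comp (fun q : E * 'I_n => (u q.1, q.2))).
have [|Gs GsG|y yP] := compactness (Gamma := Gamma) sJ sA.
- by move=> G [I0 [u [P [dP _ ->]]]]; exact: dat.
- have [S sS SP] : exists2 S : seq rat, sorted <%R S & forall G, List.In G Gs ->
      exists (I : finType) (u : I -> D -> rat) (P : (I * 'I_n -> C) -> Prop),
      [/\ {subset values d u <= S}, lim I u P & G = fun y => P (at_ (fun eta c => y (eta, c)) u)].
    elim: Gs GsG => [|G Gs IH] GsG; first by exists [::].
    have [S sS SP] := IH (fun G' h => GsG G' (or_intror h)).
    have [I [u [P [_ uP GE]]]] := GsG G (or_introl erefl).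
    exists (sort <=%R (undup (S ++ values d u))).
      by rewrite lt_sorted_uniq_le sort_uniq undup_uniq sort_le_sorted.
    move=> G' /= [<-|/SP[I' [u' [P' [uS' uP' GE']]]]].
      by exists I, u, P; split=> // x xu; rewrite mem_sort mem_undup mem_cat xu orbT.
    by exists I', u', P'; split=> // x /uS' xu; rewrite mem_sort mem_undup mem_cat xu.
  have [g gP] : exists g, forall G, List.In G Gs ->
      G (fun q => x0 (setd d (sub g) q.1) q.2).
    apply: (@ulim_ex U U_mono U_not U_tail S _ (fun=> 0%N)).
    elim: Gs {GsG} SP => [|G Gs IH] SP.
      have := ulim_increasing U_mono U_tail 0 (fun=> 0%N) sS.
      by apply: (ulim_mono U_mono).
    have [I [u [P [uS uP ->]]]] := SP G (or_introl erefl).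
    have {}IH := IH (fun G' h => SP G' (or_intror h)).
    have : ulim U S (Q I u P) (fun=> 0%N).
      rewrite (ulim_filter U_mono U_not U_tail (X := mem (values d u)) _ _ (Qloc _ _ _ _ _)) //.
      by rewrite lt_sorted_sub //; exact: sorted_values.
    move=> /(ulim_and U_mono U_and IH); apply: (ulim_mono U_mono) => g [gGs Qg] G' /= [<-|/gGs//].
    exact: Qg.
  by exists (fun q => x0 (setd d (sub g) q.1) q.2).
pose y' : fam := fun eta c => y (eta, c).
have y'P : forall (E : finType) (u : E -> D -> rat) (P : (E * 'I_n -> C) -> Prop),
    dfn A P -> P (at_ y' u) <-> lim E u P.
  move=> I u P dP; split=> [Py|limP]; last first.
    by apply: (yP (fun y => P (at_ (fun eta c => y (eta, c)) u))); exists I, u, P.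
  apply: contrapT => nlim.
  have : lim I u (fun w => ~ P w) by apply/(ulim_not U_mono U_not).
  move=> H; have : ~ P (at_ y' u); last by [].
  apply: (yP (fun y => ~ P (at_ (fun eta c => y (eta, c)) u))).
  by exists I, u, (fun w => ~ P w); split=> //; exact: dfn_not.
exists y'; split=> [I u v uvF uvN P dP|I u P dP xP].
  have uvd : order_in d u v by apply: uvF; left.
  have uvdE k l : (u k d == u l d) = (v k d == v l d).
    by rewrite !eq_le !leNgt !uvd.
  have /choice[h hP] : forall q, exists x, forall k, u k d = q -> v k d = x.
    move=> q; have [[k uk]|nk] := pselect (exists k, u k d = q).
      by exists (v k d) => l ul; apply/eqP; rewrite -uvdE uk ul.
    by exists 0 => k uk; case: nk; exists k.
  have huv k : h (u k d) = v k d by rewrite -(hP (u k d) k).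
  have hlt : {in values d u &, {homo h : s t / s < t}}.
    by move=> _ _ /mem_values[k ->] /mem_values[l ->]; rewrite !huv uvd.
  have vE : values d v = map h (values d u).
    apply: lt_sorted_eq; first exact: sorted_values.
      by apply: (homo_sorted_in hlt); [apply/allP|exact: sorted_values].
    move=> q; apply/mem_values/mapP => [[k ->]|[_ /mem_values[k ->] ->]].
      by exists (u k d) => //; apply/mem_values; exists k.
    by exists k; rewrite huv.
  (* For corresponding choices of numbers the two subfamilies agree in dimension [d], so the
     goodness of [x0] on [F] compares them. *)
  have Quv g g' : (forall s, s \in values d u -> g s = g' (h s)) -> Q I u P g <-> Q I v P g'.
    move=> gg'.
    have gu k : g (u k d) = g' (v k d) by rewrite gg' ?huv //; apply/mem_values; exists k.
    split; apply: x0F => // d' d'F.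
    - move=> k l; have [->|d'd] := pselect (d' = d); first by rewrite !setdE /sub !gu.
      by rewrite !setd_neq //; apply: uvF; right.
    - move=> k; have [->|d'd] := pselect (d' = d); first by rewrite !setdE /sub !gu.
      by rewrite !setd_neq //; apply: uvN => -[].
    - move=> k l; have [->|d'd] := pselect (d' = d); first by rewrite !setdE /sub !gu.
      by rewrite !setd_neq //; apply/esym/uvF; right.
    - move=> k; have [->|d'd] := pselect (d' = d); first by rewrite !setdE /sub !gu.
      by rewrite !setd_neq //; apply/esym/uvN => -[].
  rewrite !y'P //; rewrite /lim vE => H.
  have hinj : {in values d u &, injective h}.
    move=> s t sS tS hst; apply/eqP; rewrite eq_le !leNgt; apply/andP; split; apply/negP.
      by move=> /(hlt _ _ tS sS); rewrite hst ltxx.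
    by move=> /(hlt _ _ sS tS); rewrite hst ltxx.
  have /(_ (fun=> 0%N) (fun=> 0%N)) := ulim_map U_mono hinj (fun _ h => h) Quv.
  by move=> HH; apply/HH => // s ->.
rewrite y'P //; have := ulim_increasing U_mono U_tail 0 (fun=> 0%N) (sorted_values d u).
apply: (ulim_mono U_mono) => g [_ _ ginc]; apply: xP => [k l|k|d' d'd k].
- rewrite !setdE /sub ltr_nat.
  have mu k' : u k' d \in values d u by apply/mem_values; exists k'.
  have [kl|kl|->] := ltgtP (u k d) (u l d); last by rewrite ltnn.
    by rewrite (ginc _ _ (mu k) (mu l) kl).
  by apply/esym/negbTE; rewrite -leqNgt ltnW // (ginc _ _ (mu l) (mu k) kl).
- by exists (g (u k d)); rewrite setdE.
- by rewrite setd_neq.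
Qed.

End ExtractStep.

(** * Homogenization of all dimensions under given conditions *)

Section GoodFamily.
Local Open Scope ring_scope.
Context {L : language} {T : theory L} (C : monster T).
Variables (A : set C) (D : Type) (n : nat).
Hypotheses (sA : small C A) (sD : smallT C D).

Lemma good_on_iter (F : seq D) (x0 : fam C D n) : exists y : fam C D n,
  good_on A [set d | List.In d F] y /\
  forall (E : finType) (u : E -> D -> rat) (P : (E * 'I_n -> C) -> Prop), dfn A P ->
    (forall v : E -> D -> rat,
       (forall d, List.In d F -> order_in d u v /\ forall k, exists a, v k d = a%:R :> rat) ->
       (forall d, ~ List.In d F -> forall k, v k d = u k d) -> P (at_ x0 v)) ->
    P (at_ y u).
Proof.
elim: F => [|d F [y [yF yP]]].
  exists x0; split=> [E u v _ uv P dP|E u P dP H]; last by apply: H => // d [].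
  suff -> : u = v by [].
  by apply/funext => k; apply/funext => d; exact: uv.
have [y' [y'F y'P]] := good_on_step sA sD d yF.
exists y'; split=> [E u v uv1 uv2 P dP|E u P dP xP].
  apply: y'F => // e; first by move=> [->|eF]; apply: uv1; [left|right].
  by move=> ne; apply: uv2 => -[ed|eF]; apply: ne; [left|right].
apply: y'P => // v uv vnat vu; apply: yP => // v' v'1 v'2; apply: xP => e.
  move=> eF; have [eF'|neF'] := pselect (List.In e F).
    have [vv' v'nat] := v'1 e eF'; split=> // k l; rewrite -vv'.
    by have [->|ed] := pselect (e = d); [exact: uv|rewrite !vu].
  have ed : e = d by case: eF.
  by split=> [k l|k]; rewrite !v'2 // ed.
move=> neF k; rewrite v'2; first by apply: vu => ed; apply: neF; left.
by move=> eF; apply: neF; right.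
Qed.

Record condition := Condition {
  cnum : nat;
  cpos : 'I_cnum -> D -> rat;
  cprop : ('I_cnum * 'I_n -> C) -> Prop }.

Definition good (y : fam C D n) := forall (E : finType) (u v : E -> D -> rat),
  (forall d, order_in d u v) ->
  forall P : (E * 'I_n -> C) -> Prop, dfn A P -> P (at_ y u) -> P (at_ y v).

(** Homogenization keeps what depends on order types only. So a condition survives if the initial
    family satisfies it at all positions of the right order type, measured in finitely many
    dimensions. *)
Lemma good_family (Sigma : set condition) :
  (forall c, Sigma c -> dfn A (@cprop c)) ->
  (forall cs : seq condition, (forall c, List.In c cs -> Sigma c) ->
     exists (F : seq D) (x0 : (D -> nat) -> 'I_n -> C), forall c, List.In c cs ->
     forall v : 'I_(cnum c) -> D -> nat,
       (forall d, List.In d F -> forall k l, (cpos k d < cpos l d) = (v k d < v l d)%N) ->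
       cprop (fun q => x0 (v q.1) q.2)) ->
  exists y, good y /\ forall c, Sigma c -> cprop (at_ y (@cpos c)).
Proof.
move=> dSigma fs.
pose G1 : set (((D -> rat) * 'I_n -> C) -> Prop) := [set G |
  exists2 c, Sigma c & G = fun y => cprop (at_ (fun eta i => y (eta, i)) (@cpos c))].
pose G2 : set (((D -> rat) * 'I_n -> C) -> Prop) := [set G |
  exists (E : finType) (u v : E -> D -> rat) (P : (E * 'I_n -> C) -> Prop),
  [/\ forall d, order_in d u v, dfn A P & G = fun y =>
    P (at_ (fun eta i => y (eta, i)) u) -> P (at_ (fun eta i => y (eta, i)) v)]].
have sJ : smallT C ((D -> rat) * 'I_n).
  by apply: smallT_prod; [apply: smallT_fun => //|]; exact: smallT_count.
have dat : forall (E : finType) (u : E -> D -> rat) (P : (E * 'I_n -> C) -> Prop), dfn A P ->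
    dfn A (fun y : (D -> rat) * 'I_n -> C => P (at_ (fun eta c => y (eta, c)) u)).
  by move=> E u P; exact: (dfn_comp (fun q : E * 'I_n => (u q.1, q.2))).
have [|Gs GsG|y yP] := compactness (Gamma := G1 `|` G2) sJ sA.
- move=> _ [[c Sc ->]|[E [u [v [P [_ dP ->]]]]]]; first exact: dat (dSigma c Sc).
  by apply: dfn_imp; exact: dat.
- have [cs [csS csP]] : exists cs, (forall c, List.In c cs -> Sigma c) /\
      forall G, List.In G Gs -> G2 G \/ exists2 c, List.In c cs &
        G = fun y => cprop (at_ (fun eta i => y (eta, i)) (@cpos c)).
    elim: Gs GsG => [|G Gs IH] GsG; first by exists [::].
    have [cs [csS csP]] := IH (fun G' h => GsG G' (or_intror h)).
    have [[c Sc cG]|G2G] := GsG G (or_introl erefl); last first.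
      by exists cs; split=> // G' /= [<-|/csP//]; left.
    exists (c :: cs); split=> [c' /= [<-//|/csS//]|G' /= [<-|/csP[|[c' c's c'G]]]].
    - by right; exists c => //; left.
    - by left.
    - by right; exists c' => //; right.
  have [F [x0 x0P]] := fs cs csS.
  (* Dimensions outside [F] are collapsed to 0, which makes goodness on [F] as strong as goodness
     for the conditions at hand. *)
  pose rho (eta : D -> rat) : D -> rat := fun d => if pselect (List.In d F) then eta d else 0.
  have rhoF d eta : List.In d F -> rho eta d = eta d by rewrite /rho; case: pselect.
  have rhoN d eta : ~ List.In d F -> rho eta d = 0 by rewrite /rho; case: pselect.
  have [z [zF zP]] := good_on_iter F (fun eta => x0 (fun d => Num.truncn (eta d))).
  exists (fun q => z (rho q.1) q.2) => G /csP[[E [u [v [P [uv dP ->]]]]]|[c ccs ->]].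
    rewrite /at_ /=; apply: (zF E (rho \o u) (rho \o v)) => // d dF.
      by move=> k l /=; rewrite !rhoF //; exact: uv.
    by move=> k /=; rewrite !rhoN.
  rewrite /at_ /=; apply: (zP _ (rho \o @cpos c)); first exact: dSigma (csS c ccs).
  move=> v v1 _; apply: (x0P c ccs (fun k d => Num.truncn (v k d))) => d dF k l.
  have [/(_ k l) /= + vnat] := v1 d dF; rewrite !rhoF // => ->.
  have [[a ->] [b ->]] := (vnat k, vnat l).
  by rewrite !natrK ltr_nat.
exists (fun eta i => y (eta, i)); split=> [E u v uv P dP|c Sc].
  apply: (yP (fun y => P (at_ (fun eta i => y (eta, i)) u) ->
    P (at_ (fun eta i => y (eta, i)) v))).
  by right; exists E, u, v, P.
by apply: (yP (fun y => cprop (at_ (fun eta i => y (eta, i)) (@cpos c)))); left; exists c.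
Qed.

End GoodFamily.

(** * Dependence bounds shattering *)

Lemma InP (E : eqType) (x : E) (s : seq E) : List.In x s <-> x \in s.
Proof.
elim: s => //= z s IH; rewrite inE; split=> [[->|/IH ->]|/orP[/eqP ->|/IH]].
- by rewrite eqxx.
- by rewrite orbT.
- by left.
- by right.
Qed.

Lemma dfn_forall_fin L (M : structure L) (B : set M) J (E : finType)
    (P : E -> (J -> M) -> Prop) :
  (forall e, dfn B (P e)) -> dfn B (fun v => forall e, P e v).
Proof.
move=> dP; have /dfn_conj : forall Q, List.In Q (map P (enum E)) -> dfn B Q.
  by move=> Q /List.in_map_iff[e [<- _]].
apply: dfn_ext => v; split=> [H e|H Q /List.in_map_iff[e [<- _]]//].
by apply: H; apply/List.in_map/InP; rewrite mem_enum.
Qed.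

Definition sum_pos Q E E' (u : E -> Q) (v : E' -> Q) : E + E' -> Q :=
  fun k => match k with inl e => u e | inr e => v e end.

Section Rows.
Context {L : language} {T : theory L} (C : monster T).
Variables (A : set C) (Q : Type) (n : nat) (y : Q -> 'I_n -> C).

Lemma dfn_elements (X : set Q) (B : set C) J (P : (J -> C) -> Prop) :
  B `<=` A `|` [set c | exists x i, X x /\ c = y x i] -> dfn B P ->
  exists N (xs : 'I_N -> Q) (P' : (J + 'I_N * 'I_n -> C) -> Prop),
    [/\ forall k, X (xs k), dfn A P' & forall v, P v <-> P' (sum_asgn v (at_ y xs))].
Proof.
move=> BA [N [f [h [hB hP]]]].
have [[x0 Xx0]|nX] := pselect (exists x, X x); last first.
  have xs : 'I_0 -> Q by case.
  exists 0, xs, (fun v => P (v \o inl)); split; first by case.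
    apply: dfn_comp; exists N, f, h; split=> // k c /hB/BA[//|[x [i [Xx _]]]].
    by case: nX; exists x.
  by move=> v.
have /choice[g gP] : forall k, exists g : Q * ((J + 'I_N * 'I_n) + C),
    [/\ X g.1, forall c, g.2 = inr c -> A c & forall v xs, xs k = g.1 -> asgn h v k =
      match g.2 with inl u => sum_asgn v (at_ y xs) u | inr c => c end].
  move=> k; rewrite /asgn; case E : (h k) => [j|c]; first by exists (x0, inl (inl j)).
  have [Ac|[x [i [Xx ->]]]] := BA _ (hB k c E).
    by exists (x0, inr c); split=> //= ? [<-].
  by exists (x, inl (inr (k, i))); split=> //= v xs <-.
exists N, (fun k => (g k).1), (fun v => sat f (asgn (fun k => (g k).2) v)); split.
- by move=> k; have [] := gP k.
- exists N, f, (fun k => (g k).2); split=> // k c; have [_ + _] := gP k; exact.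
- move=> v; rewrite hP.
  suff -> : asgn h v = asgn (fun k => (g k).2) (sum_asgn v (at_ y (fun k => (g k).1))) by [].
  by apply/funext => k; have [_ _ /(_ v (fun k => (g k).1) erefl)->] := gP k.
Qed.

Lemma infinite_nat_set : infinite_set [set: nat].
Proof. exact: infinite_nat. Qed.

Definition row_sequence (R : nat -> Q) : sequence C n :=
  @Sequence C n _ nat infinite_nat_set (fun q => y (R q)).

Lemma row_sequence_indiscernible (R : nat -> Q) (X : set Q) (B : set C) :
  B `<=` A `|` [set c | exists x i, X x /\ c = y x i] ->
  (forall k (s t : 'I_k -> nat) N (xs : 'I_N -> Q),
    {homo s : i j / (i < j)%N} -> {homo t : i j / (i < j)%N} -> (forall k, X (xs k)) ->
    forall P : (('I_k + 'I_N) * 'I_n -> C) -> Prop, dfn A P ->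
    P (at_ y (sum_pos (R \o s) xs)) -> P (at_ y (sum_pos (R \o t) xs))) ->
  indiscernible B (row_sequence R).
Proof.
move=> BA H k s t sinc tinc; apply/same_typeP => P /(dfn_elements BA)[N [xs [P' [Xxs dP' PP']]]].
have dP2 : dfn A (fun v : ('I_k + 'I_N) * 'I_n -> C => P' (v \o (fun u => match u with
  inl q => (inl q.1, q.2) | inr q => (inr q.1, q.2) end))).
  exact: (dfn_comp _ dP').
have E s' : sum_asgn (fun q : 'I_k * 'I_n => row_sequence R (s' q.1) q.2) (at_ y xs) =
    at_ y (sum_pos (R \o s') xs) \o (fun u => match u with
  inl q => (inl q.1, q.2) | inr q => (inr q.1, q.2) end).
  by apply/funext => -[].
have inc (s' : 'I_k -> nat) : {homo s' : i j / (i < j)%N >-> (i < j)%O} ->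
    {homo s' : i j / (i < j)%N}.
  by move=> H' i j /H'; rewrite ltEnat.
by rewrite !PP' !E; split; apply: (H k _ _ N xs _ _ _ _ dP2) => //; exact: inc.
Qed.

End Rows.

Section NIP.
Local Open Scope ring_scope.
Context {L : language} {T : theory L} (C : monster T).
Variables (A : set C) (n l : nat) (p : set (pformula C n)) (K0 : Type).
Variable phi : ('I_n + 'I_l -> C) -> Prop.
Hypotheses (sA : small C A) (sK : smallT C K0) (pA : forall f, p f -> params_in A f).
Hypotheses (rk : rk_dp_lt A p K0) (dphi : dfn A phi).

(** Only finitely many formulas of [p] are kept, so that the relation is definable. *)
Let shatters (fs : seq (pformula C n)) N (S : 'I_N -> bool) (b : 'I_N * 'I_l -> C) :=
  exists x : 'I_n -> C, (forall f, List.In f fs -> holds x f) /\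
    forall k, phi (sum_asgn x (fun i => b (k, i))) <-> S k.

Lemma dfn_shatters fs N (S : 'I_N.+1 -> bool) : (0 < l)%N ->
  (forall f, List.In f fs -> p f) -> dfn A (@shatters fs N.+1 S).
Proof.
move=> l0 fsp.
have d1 : dfn A (fun v : 'I_N.+1 * 'I_l + 'I_n -> C =>
    forall f, List.In f fs -> holds (v \o inr) f).
  elim: fs fsp {S} => [|f fs IH] fsp.
    by apply: dfn_ext (dfn_not (dfn_false _ _)) => v; split=> [_ f []|_ []].
  have df := dfn_holds (J := 'I_N.+1 * 'I_l + 'I_n) inr (pA (fsp f (or_introl erefl))).
  apply: dfn_ext (dfn_and df (IH (fun f' h => fsp f' (or_intror h)))) => v.
  split=> [[fv fsv] f' /= [<-//|/fsv//]|H]; split=> [|f' f'fs]; apply: H; by [left|right].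
have d2 : dfn A (fun v : 'I_N.+1 * 'I_l + 'I_n -> C =>
    forall k, phi (sum_asgn (v \o inr) (fun i => v (inl (k, i)))) <-> S k).
  have dk k : dfn A (fun v : 'I_N.+1 * 'I_l + 'I_n -> C =>
      phi (sum_asgn (v \o inr) (fun i => v (inl (k, i)))) <-> S k).
    have dphi' := dfn_comp (fun u => match u with inl i => inr i | inr i => inl (k, i) end :
      'I_N.+1 * 'I_l + 'I_n) dphi.
    have E (v : 'I_N.+1 * 'I_l + 'I_n -> C) :
      v \o (fun u => match u with inl i => inr i | inr i => inl (k, i) end) =
      sum_asgn (v \o inr) (fun i => v (inl (k, i))) by apply/funext => -[].
    case: (S k); [apply: dfn_ext dphi'|apply: dfn_ext (dfn_not dphi')] => v; rewrite E.
      by split=> [h|[_ h]]; [split|exact: h].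
    by split=> [h|[h _] /h //]; split=> // /h.
  exact: dfn_forall_fin dk.
have := dfn_existsW (ord0, Ordinal l0) (dfn_and d1 d2).
apply: dfn_ext => v; rewrite /shatters.
by split=> -[x [x1 x2]]; exists x; split=> // k.
Qed.
Let J0 := ((K0 -> nat) * 'I_l)%type.

Let shattered (G : (J0 -> C) -> Prop) (etas : seq (K0 -> nat)) :=
  exists N (v : 'I_N.+1 -> K0 -> nat) (S : 'I_N.+1 -> bool) fs,
  [/\ injective v, forall k, List.In (v k) etas, forall f, List.In f fs -> p f &
    G = fun b => shatters fs S (fun q => b (v q.1, q.2))].

(** Compactness passes from shattered sets of every finite size to one family. The index set
    [K0 -> nat] provides one dimension for each of the rows wanted later. *)
Lemma shattered_family : (0 < l)%N ->
  (forall m, exists b : 'I_m -> 'I_l -> C, forall S : 'I_m -> bool,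
     exists x, realizes x p /\ forall k, phi (sum_asgn x (b k)) <-> S k) ->
  exists b : (K0 -> nat) -> 'I_l -> C, forall N (v : 'I_N.+1 -> K0 -> nat)
    (S : 'I_N.+1 -> bool) fs, injective v -> (forall f, List.In f fs -> p f) ->
    shatters fs S (fun q => b (v q.1) q.2).
Proof.
move=> l0 sh.
pose Gamma : set ((J0 -> C) -> Prop) := [set G | exists etas, shattered G etas].
have sJ : smallT C J0.
  by apply: smallT_prod; [apply: smallT_fun => //|]; exact: smallT_count.
have [|Gs GsG|b bP] := compactness (Gamma := Gamma) sJ sA.
- move=> _ [_ [N [v [S [fs [_ _ fsp ->]]]]]].
  exact: (dfn_comp (fun q => (v q.1, q.2)) (dfn_shatters S l0 fsp)).
- have [etas etasP] : exists etas, forall G, List.In G Gs -> shattered G etas.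
    elim: Gs GsG => [|G Gs IH] GsG; first by exists [::].
    have [etas etasP] := IH (fun G' h => GsG G' (or_intror h)).
    have [etas' [N [v [S [fs [vi vin fsp GE]]]]]] := GsG G (or_introl erefl).
    exists (etas' ++ etas) => G' /= [<-|/etasP[N' [v' [S' [fs' [vi' vin' fsp' GE']]]]]].
      by exists N, v, S, fs; split=> // k; apply/List.in_or_app; left.
    by exists N', v', S', fs'; split=> // k; apply/List.in_or_app; right.
  pose es := (etas : seq {classic (K0 -> nat)}).
  have [b bP] := sh (size es).
  have [pt] := carrier_inhabited C.
  exists (fun q => if insub (index (q.1 : {classic (K0 -> nat)}) es) is Some k
    then b k q.2 else pt) => _ /etasP[N [v [S [fs [vi vin fsp ->]]]]].
  have vlt k : (index (v k : {classic (K0 -> nat)}) es < size es)%N.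
    by rewrite index_mem; apply/InP; exact: vin.
  have [x [xp xS]] := bP (fun j => `[< exists k, v k = tnth (in_tuple es) j /\ S k >]).
  exists x; split=> [f /fsp/xp //|k].
  have E : insub (index (v k : {classic (K0 -> nat)}) es) = Some (Ordinal (vlt k)).
    by rewrite (insubT (fun i => (i < size es)%N) (vlt k)).
  rewrite [X in sum_asgn x X](_ : _ = b (Ordinal (vlt k))); last first.
    by apply/funext => i; rewrite /= E.
  rewrite xS; split=> [/asboolP[k' [vk Sk']]|Sk].
    suff <- : k' = k by []; apply: vi; rewrite vk (tnth_nth (v k)) /= nth_index //.
    by rewrite -index_mem.
  apply/asboolP; exists k; split=> //.
  by rewrite (tnth_nth (v k)) /= nth_index // -index_mem.
exists (fun eta i => b (eta, i)) => N v S fs vi fsp.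
apply: (bP (fun b => shatters fs S (fun q => b (v q.1, q.2)))).
exists [seq v k | k <- enum 'I_N.+1], N, v, S, fs; split=> // k.
by apply/List.in_map/InP; rewrite mem_enum.
Qed.

Lemma shattered_good_family : (0 < l)%N ->
  (forall m, exists b : 'I_m -> 'I_l -> C, forall S : 'I_m -> bool,
     exists x, realizes x p /\ forall k, phi (sum_asgn x (b k)) <-> S k) ->
  exists b : fam C K0 l, good A b /\ forall N (v : 'I_N.+1 -> K0 -> rat)
    (S : 'I_N.+1 -> bool) fs, injective v -> (forall f, List.In f fs -> p f) ->
    shatters fs S (at_ b v).
Proof.
move=> l0 /(shattered_family l0)[x0 x0P].
pose Sigma (c : condition C K0 l) := exists N (v : 'I_N.+1 -> K0 -> rat) (S : 'I_N.+1 -> bool) fs,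
  [/\ injective v, forall f, List.In f fs -> p f & c = Condition v (@shatters fs N.+1 S)].
have [|cs csP|b [bgood bP]] := good_family sA sK (Sigma := Sigma).
- by move=> _ [N [v [S [fs [_ fsp ->]]]]]; exact: dfn_shatters.
(* [F] separates the positions of each condition. Positions with the same order types in [F] are
   then distinct too, as shattering requires. *)
- have [F FP] : exists F, forall c, List.In c cs -> Sigma c /\
      forall k l, k <> l -> exists2 d, List.In d F & cpos (c := c) k d <> cpos l d.
    elim: cs csP => [|c cs IH] csP; first by exists [::].
    have [F FP] := IH (fun c' h => csP c' (or_intror h)).
    have [Fc FcP] : exists Fc, forall k l, k <> l ->
        exists2 d, List.In d Fc & cpos (c := c) k d <> cpos l d.
      have [N [v [S [fs [vi _ cE]]]]] := csP c (or_introl erefl).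
      have /choice[g gP] : forall q : 'I_(cnum c) * 'I_(cnum c), exists ds, q.1 <> q.2 ->
          exists2 d, List.In d ds & cpos q.1 d <> cpos q.2 d.
        move=> [k k'] /=; have [<-|nkk'] := pselect (k = k'); first by exists [::].
        have /existsNP[d dP] : ~ forall d, cpos k d = cpos k' d.
          by move: k k' nkk'; rewrite cE /= => k k' nkk' vv'; apply/nkk'/vi/funext.
        by exists [:: d] => _; exists d => //; left.
      exists (List.concat (map g (enum {: 'I_(cnum c) * 'I_(cnum c)}))) => k k' nkk'.
      have [d dd dne] := gP (k, k') nkk'; exists d => //.
      apply/List.in_concat; exists (g (k, k')); split=> //.
      by apply/List.in_map/InP; rewrite mem_enum.
    exists (Fc ++ F) => c' /= [<-|/FP[Sc' c'P]].
      split; first by apply: csP; left.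
      by move=> k k' /FcP[d dF dne]; exists d => //; apply/List.in_or_app; left.
    split=> // k k' /c'P[d dF dne]; exists d => //; apply/List.in_or_app; by right.
  exists F, x0 => c /FP[[N [v [S [fs [vi fsp cE]]]]] cF].
  move: cF; rewrite cE /= => cF u uv.
  apply: (x0P N u S fs) => // k k' ukk'; apply: contrapT => /cF[d dF]; apply.
  by apply/eqP; rewrite eq_le !leNgt !uv // ukk' !ltnn.
exists b; split=> // N v S fs vi fsp.
by apply: (bP (Condition v (@shatters fs N.+1 S))); exists N, v, S, fs.
Qed.

(* A shattered grid with the coordinates of [K0 -> rat] as indices gives one row
   for each i in K0, and one realization of p breaks all of these mutually
   indiscernible rows. *)
Lemma rk_dp_lt_nip : exists m, ~ exists b : 'I_m -> 'I_l -> C, forall S : 'I_m -> bool,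
  exists x, realizes x p /\ forall k, phi (sum_asgn x (b k)) <-> S k.
Proof.
apply: contrapT => /forallNP sh0.
have sh m : exists b : 'I_m -> 'I_l -> C, forall S : 'I_m -> bool,
     exists x, realizes x p /\ forall k, phi (sum_asgn x (b k)) <-> S k.
  by apply: contrapT; exact: sh0.
have l0 : (0 < l)%N.
  rewrite lt0n; apply/eqP => l0; have [b bP] := sh 2.
  have [x [_ xP]] := bP (fun k => k == ord0).
  have b01 : b ord0 = b ord_max.
    by apply/funext => -[i ilt]; exfalso; move: ilt; rewrite l0.
  by have := xP ord_max; rewrite -b01 xP eqxx => -[/(_ isT)].
have [b [bgood bP]] := shattered_good_family l0 sh.
(* The successor keeps row [k] above 0 in dimension [k], where all the other rows have the value 0
   and thus do not cut it. *)
pose eta (k : K0) (q : nat) : K0 -> rat := fun d => if pselect (d = k) then q.+1%:R else 0.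
have etaE k q : eta k q k = q.+1%:R by rewrite /eta; case: pselect.
have eta0 k q d : d <> k -> eta k q d = 0 by rewrite /eta; case: pselect.
have eta_inj k q k' q' : eta k q = eta k' q' -> k = k' /\ q = q'.
  move=> E; have kk' : k = k'.
    apply: contrapT => nkk'; have := congr1 (fun f => f k) E.
    by rewrite /= etaE eta0 // => /eqP; rewrite pnatr_eq0.
  split=> //; have := congr1 (fun f => f k) E.
  by rewrite /= etaE kk' etaE => /eqP; rewrite eqr_nat => /eqP[].
pose row k := row_sequence b (eta k).
pose Gamma : set (('I_n -> C) -> Prop) := [set G | (exists2 f, p f & G = holds (n := n) ^~ f) \/
  exists (u : K0 * bool), G = fun x => phi (sum_asgn x (b (eta u.1 (nat_of_bool u.2)))) <-> u.2].
pose B := A `|` range (fun u : (K0 * bool) * 'I_l => b (eta u.1.1 (nat_of_bool u.1.2)) u.2).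
have sB : small C B.
  apply: smallU => //; apply: (@small_range _ _ _ ((K0 * bool) * 'I_l)%type); last by move=> c; apply.
  by apply: smallT_prod; [apply: smallT_prod => //|]; exact: smallT_count.
have [|Gs GsG|a aP] := compactness (Gamma := Gamma) (smallT_count C 'I_n) sB.
- move=> _ [[f pf ->]|[u ->]].
    apply: dfn_subset (dfn_holds id (pA pf)); by left.
  have s0B : forall z c, (match z with inl i => inl i | inr i =>
      inr (b (eta u.1 (nat_of_bool u.2)) i) end : 'I_n + C) = inr c -> B c.
    by move=> [//|i] c [<-]; right; exists (u, i).
  have := dfn_subst s0B (dfn_subset (@subsetUl _ A _) dphi).
  have E (x : 'I_n -> C) : (fun j => match match j with inl i => inl i | inr i =>
      inr (b (eta u.1 (nat_of_bool u.2)) i) end with inl i => x i | inr c => c end) =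
      sum_asgn x (b (eta u.1 (nat_of_bool u.2))) by apply/funext => -[].
  case: (u.2) E => E d0; [apply: dfn_ext d0|apply: dfn_ext (dfn_not d0)] => x; rewrite E.
    by split=> [h|[_ h]]; [split|exact: h].
  by split=> [h|[h _] /h //]; split=> // /h.
- have [fs [us [fsp GsP]]] : exists fs (us : seq {classic (K0 * bool)}),
     (forall f, List.In f fs -> p f) /\
     forall G, List.In G Gs -> (exists2 f, List.In f fs & G = holds (n := n) ^~ f) \/
       exists2 u, u \in us & G = fun x => phi (sum_asgn x (b (eta u.1 (nat_of_bool u.2)))) <-> u.2.
    elim: Gs GsG => [|G Gs IH] GsG; first by exists [::], [::].
    have [fs [us [fsp GsP]]] := IH (fun G' h => GsG G' (or_intror h)).
    have [[f pf GE]|[u GE]] := GsG G (or_introl erefl).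
      exists (f :: fs), us; split=> [f' /= [<-//|/fsp//]|G' /= [<-|/GsP[[f' ff fE]|]]].
      - by left; exists f => //; left.
      - by left; exists f' => //; right.
      - by right.
    exists fs, (u :: us); split=> // G' /= [<-|/GsP[|[u' uu uE]]].
    - by right; exists u => //; rewrite inE eqxx.
    - by left.
    - by right; exists u' => //; rewrite inE uu orbT.
  have : {subset us <= undup us} by move=> u; rewrite mem_undup.
  have : uniq (undup us) by exact: undup_uniq.
  case: (undup us) => [_ us0|u0 us' uus usus].
    have [b0 b0P] := sh 0%N; have [x [xp _]] := b0P (fun=> true).
    exists x => G /GsP[[f ffs ->]|[u /us0]]; last by rewrite in_nil.
    exact/xp/fsp.
  pose tn := tnth (in_tuple (u0 :: us')).
  have tnE k : tn k = nth u0 (u0 :: us') k by rewrite /tn (tnth_nth u0).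
  have [|x [xfs xS]] := bP _ (fun k => eta (tn k).1 (nat_of_bool (tn k).2))
    (fun k => (tn k).2) fs _ fsp.
    move=> k k' /eta_inj[]; case E : (tn k) => [u e]; case E' : (tn k') => [u' e'] /= uu ee.
    have tt' : tn k = tn k' by rewrite E E' uu; congr (_, _); case: e e' ee {E E'} => -[].
    move: tt'; rewrite !tnE => /eqP; rewrite nth_uniq ?ltn_ord // => /eqP; exact: val_inj.
  exists x => G /GsP[[f ffs ->]|[u /usus uus' ->]]; first exact: xfs.
  have ult : (index u (u0 :: us') < (size us').+1)%N by rewrite -/(size (u0 :: us')) index_mem.
  have tnu : tn (Ordinal ult) = u by rewrite tnE nth_index.
  have := xS (Ordinal ult); rewrite tnu.
  by rewrite [X in sum_asgn x X](_ : _ = b (eta u.1 (nat_of_bool u.2))) //;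
    apply/funext => i; rewrite /at_ /= tnu.
have ap : realizes a p by move=> f pf; apply: (aP (holds (n := n) ^~ f)); left; exists f.
have aphi k (e : bool) : phi (sum_asgn a (b (eta k e))) <-> e.
  by apply: (aP (fun x => phi (sum_asgn x (b (eta k e))) <-> e)); right; exists (k, e).
have [||k indk] := rk (a := a) (I := row) ap.
- by move=> k; exact: smallT_count.
- move=> k; apply: (row_sequence_indiscernible (A := A) (X := [set x | exists k' q, k' <> k /\ x = eta k' q])).
  + move=> c [Ac|[j jk [q [i <-]]]]; first by left.
    by right; exists (eta j q), i; split=> //; exists j, q.
  + move=> N s t M xs sinc tinc xsX P dP.
    suff H d : order_in d (sum_pos (eta k \o s) xs) (sum_pos (eta k \o t) xs).
      exact: (bgood ('I_N + 'I_M)%type _ _ H P dP).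
    have inc (s' : 'I_N -> nat) i j : {homo s' : i j / (i < j)%N} -> (s' i < s' j)%N = (i < j)%N.
      move=> s'inc; have [ij|ji|/val_inj ->] := ltngtP i j; last by rewrite ltnn.
        exact: s'inc.
      by apply/negbTE; rewrite -leqNgt ltnW // s'inc.
    have [->|dk] := pselect (d = k); last first.
      by move=> [i|i] [j|j] //=; rewrite !eta0.
    have xs0 i : xs i k = 0 by have [k' [q [k'k ->]]] := xsX i; rewrite eta0 // => /esym.
    by move=> [i|i] [j|j]; rewrite /= ?xs0 ?etaE ?ltr_nat ?ltnS ?inc // ?ltr0n // ?ltrn0.
have inc1 (c : nat) : {homo (fun _ : 'I_1 => c) : i j / (i < j)%N >-> (i < j)%O}.
  by move=> i j; rewrite !ord1.
have /same_typeP/(_ (fun v => phi (sum_asgn a (fun i => v (ord0, i))))) :=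
  indk 1%N (fun=> 1%N) (fun=> 0%N) (inc1 _) (inc1 _).
case.
  have saB (z : 'I_n + 'I_l) c : match z with inl i => inr (a i) | inr i => inl (ord0, i) end =
      inr c :> ('I_1 * 'I_l) + C -> (A `|` range a) c.
    by case: z => // i [<-]; right; exists i.
  apply: dfn_ext (dfn_subst saB (dfn_subset (@subsetUl _ A _) dphi)) => v.
  by rewrite (_ : (fun _ => _) = sum_asgn a (fun i => v (ord0, i))) //; apply/funext => -[].
have /= := aphi k true; have /= := aphi k false.
by move=> f1 f2 H _; have := H (f2.2 isT); move=> /f1.
Qed.

End NIP.

(** * Broken dimensions *)

Local Open Scope ring_scope.

(* A letter has its own value in the dimension [di] and the increasing value
   [tau l] in all the others. *)
Definition tau (l : nat) : rat := 1 - l.+1%:R^-1.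

Lemma tau_ge0 l : 0 <= tau l.
Proof. by rewrite subr_ge0 invf_le1 ?ltr0n // ler1n. Qed.

Lemma tau_lt1 l : tau l < 1.
Proof. by rewrite ltrBlDr ltrDl invr_gt0 ltr0n. Qed.

Lemma tau_homo : {homo tau : l l' / (l < l')%N >-> l < l'}.
Proof. by move=> l l' ll'; rewrite ltrD2l ltrN2 ltf_pV2 ?posrE ?ltr0n // ltr_nat. Qed.

Lemma homo_lt_ord k (a : 'I_k -> rat) :
  {homo a : i j / (i < j)%N >-> i < j} -> forall i j, (a i < a j) = (i < j)%N.
Proof.
move=> ainc i j; have [ij|ji|/val_inj ->] := ltngtP i j; last by rewrite ltxx.
  exact: ainc.
by apply/negbTE; rewrite -leNgt ltW // ainc.
Qed.

Lemma order_in_sum D (d : D) E E' (a b : E -> D -> rat) (e e' : E' -> D -> rat) :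
  order_in d a b -> order_in d e e' ->
  (forall i z, (a i d < e z d) = (b i d < e' z d)) ->
  (forall i z, (e z d < a i d) = (e' z d < b i d)) ->
  order_in d (sum_pos a e) (sum_pos b e').
Proof. by move=> ab ee ae ea [i|z] [j|z'] /=. Qed.

Lemma order_in_homo D (d : D) k (a b : 'I_k -> D -> rat) :
  {homo (fun i => a i d) : i j / (i < j)%N >-> i < j} ->
  {homo (fun i => b i d) : i j / (i < j)%N >-> i < j} -> order_in d a b.
Proof. by move=> ainc binc i j; rewrite (homo_lt_ord ainc) (homo_lt_ord binc). Qed.

Lemma order_in_cut D (d : D) E E' (a b : E -> D -> rat) (e e' : E' -> D -> rat) :
  order_in d a b -> order_in d e e' ->
  (forall i z, (e z d < a i d /\ e' z d < b i d) \/ (a i d < e z d /\ b i d < e' z d)) ->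
  order_in d (sum_pos a e) (sum_pos b e').
Proof.
move=> ab ee ae; apply: order_in_sum => // i z;
by have [[H H']|[H H']] := ae i z; rewrite ?H ?H' // !ltNge !ltW.
Qed.

Section Broken.
Context {L : language} {T : theory L} (C : monster T).
Variables (A : set C) (D : Type) (n : nat) (y : fam C D n).
Hypothesis ygood : good A y.
Variable di : D.

Definition idx (j t : rat) : D -> rat := fun d => if pselect (d = di) then j else t.

Lemma idx_di j t : idx j t di = j. Proof. by rewrite /idx; case: pselect. Qed.

Lemma idx_neq j t d : d <> di -> idx j t d = t. Proof. by rewrite /idx; case: pselect. Qed.

Definition letters (X : nat -> rat) : nat -> D -> rat := fun l => idx (X l) (tau l).

(** [e] cuts the row in no dimension; 0 and 1 are the bounds of [tau]. In [outside_cons] the lower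
    bound is -1, the place of the prepended letter. *)
Definition outside (X : nat -> rat) (e : D -> rat) :=
  ((forall l, e di < X l) \/ (forall l, X l < e di)) /\
  forall d, d <> di -> e d < 0 \/ 1 <= e d.

Definition outside_cons (x : rat) (X : nat -> rat) (e : D -> rat) :=
  ((e di < x /\ forall l, e di < X l) \/ (x < e di /\ forall l, X l < e di)) /\
  forall d, d <> di -> e d < -1 \/ 1 <= e d.

Definition letters_indiscernible (X : nat -> rat) :=
  forall k (s t : 'I_k -> nat) N (e : 'I_N -> D -> rat),
  {homo s : i j / (i < j)%N} -> {homo t : i j / (i < j)%N} -> (forall z, outside X (e z)) ->
  forall P : (('I_k + 'I_N) * 'I_n -> C) -> Prop, dfn A P ->
    P (at_ y (sum_pos (letters X \o s) e)) -> P (at_ y (sum_pos (letters X \o t) e)).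

(** Boundedness allows the row to be rescaled into an interval of fixed length in the final
    layout. *)
Definition bounded_letters (X : nat -> rat) := exists B, forall l, `|X l| <= B.

(* The letter x comes first in all dimensions but [di], so it can be put in
   front of X without changing the order type outside of [di]; being broken
   says that this destroys indiscernibility of X. *)
Definition broken := exists (x : rat) (X : nat -> rat) N (e : 'I_N -> D -> rat) k (s t : 'I_k -> nat)
    (P : (('I_k + (unit + 'I_N)) * 'I_n -> C) -> Prop),
  [/\ bounded_letters X /\ letters_indiscernible X, forall z, outside_cons x X (e z),
      {homo s : i j / (i < j)%N} /\ {homo t : i j / (i < j)%N}, dfn A P &
      P (at_ y (sum_pos (letters X \o s) (sum_pos (fun=> idx x (-1)) e))) /\
      ~ P (at_ y (sum_pos (letters X \o t) (sum_pos (fun=> idx x (-1)) e)))].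

(** [v] counts the irregular letters: from place [v] on, each letter exceeds all earlier ones, the
    irregular ones included. *)
Definition eventually_chain (v : nat) (X : nat -> rat) :=
  forall l l', (l < l')%N -> (v <= l')%N -> X l < X l'.

Lemma good_sum k N (a b : 'I_k -> D -> rat) (e e' : 'I_N -> D -> rat) :
  (forall d, order_in d (sum_pos a e) (sum_pos b e')) ->
  forall P : (('I_k + 'I_N) * 'I_n -> C) -> Prop, dfn A P ->
    P (at_ y (sum_pos a e)) -> P (at_ y (sum_pos b e')).
Proof. by move=> H P dP; exact: (@ygood ('I_k + 'I_N)%type _ _ H P dP). Qed.

Lemma letters_homo X k (s : 'I_k -> nat) d :
  {homo s : i j / (i < j)%N} -> {homo (fun i => X (s i)) : i j / (i < j)%N >-> i < j} ->
  {homo (fun i => (letters X \o s) i d) : i j / (i < j)%N >-> i < j}.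
Proof.
move=> sinc Xinc i j ij; rewrite /letters /=; have [->|dd] := pselect (d = di).
  by rewrite !idx_di; exact: Xinc.
by rewrite !idx_neq //; apply/tau_homo/sinc.
Qed.

Lemma letters_bounds X l d : d <> di -> 0 <= letters X l d < 1.
Proof. by move=> dd; rewrite /letters idx_neq // tau_ge0 tau_lt1. Qed.

Lemma outside_order k N (a b : 'I_k -> D -> rat) (e : 'I_N -> D -> rat) X :
  (forall d, order_in d a b) -> (forall z, outside X (e z)) ->
  (forall i, exists l, a i di = X l) -> (forall i, exists l, b i di = X l) ->
  (forall i d, d <> di -> 0 <= a i d < 1) -> (forall i d, d <> di -> 0 <= b i d < 1) ->
  forall d, order_in d (sum_pos a e) (sum_pos b e).
Proof.
move=> ab eX aX bX a01 b01 d; apply: order_in_cut => // i z.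
have [eXz ez] := eX z; have [->|dd] := pselect (d = di).
  by have [[l ->] [l' ->]] := (aX i, bX i); case: eXz => H; [left|right].
have /andP[a0 a1] := a01 i d dd; have /andP[b0 b1] := b01 i d dd.
by case: (ez d dd) => H; [left|right]; split; lra.
Qed.

Definition cons_letter (x : rat) k (a : 'I_k -> D -> rat) : 'I_k.+1 -> D -> rat :=
  fun i => oapp a (idx x (-1)) (unlift ord0 i).

Lemma cons_letter0 x k (a : 'I_k -> D -> rat) : cons_letter x a ord0 = idx x (-1).
Proof. by rewrite /cons_letter unlift_none. Qed.

Lemma cons_letterS x k (a : 'I_k -> D -> rat) i : cons_letter x a (lift ord0 i) = a i.
Proof. by rewrite /cons_letter liftK. Qed.

Lemma cons_letter_neq x k (a : 'I_k -> D -> rat) i d : d <> di ->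
  (forall j, 0 <= a j d < 1) -> -1 <= cons_letter x a i d < 1.
Proof.
move=> dd a01; case: (unliftP ord0 i) => [j ->|->].
  by rewrite cons_letterS; have /andP[? ?] := a01 j; apply/andP; split; lra.
by rewrite cons_letter0 idx_neq //; lra.
Qed.

Lemma cons_letter_homo x k (a : 'I_k -> D -> rat) d :
  {homo (fun i => a i d) : i j / (i < j)%N >-> i < j} ->
  (forall i, idx x (-1) d < a i d) ->
  {homo (fun i => cons_letter x a i d) : i j / (i < j)%N >-> i < j}.
Proof.
move=> ainc xa i j; case: (unliftP ord0 j) => [j' ->|->]; last by rewrite ltn0.
rewrite cons_letterS; case: (unliftP ord0 i) => [i' ->|->]; last by rewrite cons_letter0.
by rewrite cons_letterS; exact: ainc.
Qed.

(** Makes room for a letter at -1: what lies below the row in another dimension gets below -1, and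
    no order relation changes. *)
Definition push_down (e : D -> rat) : D -> rat :=
  fun d => if pselect (d = di) then e d else if e d < 0 then e d - 1 else e d.

Lemma push_down_di e : push_down e di = e di.
Proof. by rewrite /push_down; case: pselect. Qed.

Lemma push_down_neq e d : d <> di -> push_down e d = if e d < 0 then e d - 1 else e d.
Proof. by rewrite /push_down; case: pselect. Qed.

Lemma push_down_order N (e : 'I_N -> D -> rat) d : order_in d e (push_down \o e).
Proof.
move=> i j /=; have [->|dd] := pselect (d = di); first by rewrite !push_down_di.
rewrite !push_down_neq //.
by case: ifP => ei; case: ifP => ej; apply/idP/idP; lra.
Qed.

Lemma push_down_cut X e a b d : outside X e ->
  (exists l, a di = X l) -> (exists l, b di = X l) ->
  (d <> di -> 0 <= a d < 1) -> (d <> di -> -1 <= b d < 1) ->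
  (e d < a d /\ push_down e d < b d) \/ (a d < e d /\ b d < push_down e d).
Proof.
move=> [eX ez] [l al] [l' bl] a01 b01; have [->|dd] := pselect (d = di).
  by rewrite push_down_di al bl; case: eX => H; [left|right].
rewrite push_down_neq //; have /andP[a0 a1] := a01 dd; have /andP[b0 b1] := b01 dd.
by case: (ez d dd) => H; [left|right]; case: ifP => H'; split; lra.
Qed.

(* By induction on the number of irregular letters: the first letter is prepended
   to an indiscernible row, whose tail is moved into the final chain. *)
Lemma eventually_chain_indiscernible v X : ~ broken -> bounded_letters X ->
  eventually_chain v X -> letters_indiscernible X.
Proof.
move=> nb; elim: v X => [|v IH] X bX XC k s t N e sinc tinc eX P dP.
  apply: good_sum => //; apply: (outside_order (X := X)) => // [d|i|i|i d|i d].
  - by apply: order_in_homo; apply: letters_homo => // i j ij; apply: XC => //;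
      [exact: sinc|exact: tinc].
  - by exists (s i); rewrite /letters /= idx_di.
  - by exists (t i); rewrite /letters /= idx_di.
  - exact: letters_bounds.
  - exact: letters_bounds.
(* These positions lie past the irregular letters. It suffices to move any positions to these, since
   the move for [~ P] gives the way back to [t]. *)
pose f (j : 'I_k) := (v.+1 + j)%N.
have finc : {homo f : i j / (i < j)%N} by move=> i j ij; rewrite ltn_add2l.
suff far (s' : 'I_k -> nat) : {homo s' : i j / (i < j)%N} ->
    forall Q : (('I_k + 'I_N) * 'I_n -> C) -> Prop, dfn A Q ->
    Q (at_ y (sum_pos (letters X \o s') e)) -> Q (at_ y (sum_pos (letters X \o f) e)).
  move=> Ps; apply: contrapT => nPt.
  have := far s sinc P dP Ps; have /= := far t tinc _ (dfn_not dP) nPt; exact.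
move: s' => {tinc t P dP sinc}s sinc P dP.
pose X' l := X l.+1.
have X'C : eventually_chain v X' by move=> l l' ll' vl'; apply: XC.
have bX' : bounded_letters X' by have [b bP] := bX; exists b => l; exact: bP.
have indX' := IH X' bX' X'C.
have eX' z : outside X' (e z).
  by have [[H|H] ?] := eX z; split=> //; [left|right] => l; exact: H.
have Xf : {homo (fun i => X (f i)) : i j / (i < j)%N >-> i < j}.
  by move=> i j ij; apply: XC; [exact: finc|exact: leq_addr].
have fE i : f i = (v + i).+1 by [].
case: k s f finc fE Xf sinc P dP => [|k] s f finc fE Xf sinc P dP.
  by rewrite (_ : letters X \o s = letters X \o f) //; apply/funext => -[].
(* If letter 0 does not occur, everything happens in the tail [X'], which has one irregular letter
   less. *)
have [s0|s0] := posnP (s ord0); last first.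
  have sgt0 i : (0 < s i)%N.
    have [->//|i0] := eqVneq i ord0; apply: leq_trans s0 (ltnW (sinc _ _ _)).
    by rewrite /= lt0n.
  pose s' i := (s i).-1; pose f' (i : 'I_k.+1) := (v + i)%N.
  have shift (g g' : 'I_k.+1 -> nat) : {homo g : i j / (i < j)%N} ->
      (forall i, g i = (g' i).+1) -> forall d, order_in d (letters X \o g) (letters X' \o g').
    move=> ginc gg' d; have [->|dd] := pselect (d = di).
      by move=> i j; rewrite /letters /= !idx_di /X' !gg'.
    apply: order_in_homo => i j ij; rewrite /letters /= !idx_neq //; apply/tau_homo.
      exact: ginc.
    by rewrite -ltnS -!gg'; exact: ginc.
  have sE i : s i = (s' i).+1 by rewrite /s' prednK.
  have s'inc : {homo s' : i j / (i < j)%N} by move=> i j ij; rewrite -ltnS -!sE; exact: sinc.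
  have f'inc : {homo f' : i j / (i < j)%N} by move=> i j ij; rewrite ltn_add2l.
  move=> Ps.
  have Ps' : P (at_ y (sum_pos (letters X' \o s') e)).
    apply: (good_sum _ dP Ps); apply: (outside_order (X := X)) => // [d|i|i|i d|i d].
    - exact: shift.
    - by exists (s i); rewrite /letters /= idx_di.
    - by exists (s i); rewrite /letters /= idx_di /X' sE.
    - exact: letters_bounds.
    - exact: letters_bounds.
  have Pf' := indX' _ _ _ _ _ s'inc f'inc eX' P dP Ps'.
  apply: (good_sum _ dP Pf'); apply: (outside_order (X := X)) => // [d|i|i|i d|i d].
  - by move=> i j; exact: esym (shift f f' finc (fun i => fE i) d i j).
  - by exists (f i); rewrite /letters /= idx_di /X' fE.
  - by exists (f i); rewrite /letters /= idx_di.
  - exact: letters_bounds.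
  - exact: letters_bounds.
pose s1 (j : 'I_k) := (s (lift ord0 j)).-1; pose f1 (j : 'I_k) := (v + j)%N.
have s1E j : s (lift ord0 j) = (s1 j).+1.
  by rewrite /s1 prednK //; apply: leq_trans (sinc ord0 _ _).
have s1inc : {homo s1 : i j / (i < j)%N}.
  by move=> i j ij; rewrite -ltnS -!s1E; apply: sinc; rewrite !lift0.
have f1inc : {homo f1 : i j / (i < j)%N} by move=> i j ij; rewrite ltn_add2l.
pose cs g := cons_letter (X 0%N) (letters X' \o (g : 'I_k -> nat)).
have csX (g : 'I_k -> nat) i : exists l, cs g i di = X l.
  rewrite /cs; case: (unliftP ord0 i) => [j ->|->].
    by exists (g j).+1; rewrite cons_letterS /letters /= idx_di.
  by exists 0%N; rewrite cons_letter0 idx_di.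
have cs01 (g : 'I_k -> nat) i d : d <> di -> -1 <= cs g i d < 1.
  by move=> dd; apply: cons_letter_neq => // j; exact: letters_bounds.
have cshomo (g : 'I_k -> nat) d : d <> di -> {homo g : i j / (i < j)%N} ->
    {homo (fun i => cs g i d) : i j / (i < j)%N >-> i < j}.
  move=> dd ginc; apply: cons_letter_homo => [i j ij|i].
    by rewrite /letters /= !idx_neq //; apply/tau_homo/ginc.
  by rewrite /letters /= !idx_neq //; have := tau_ge0 (g i); lra.
pose e' := push_down \o e.
move=> Ps.
(* Letter 0 moves from [tau 0] to -1 in the other dimensions; as the outside indices are pushed
   down, the order type is unchanged. *)
have Ps1 : P (at_ y (sum_pos (cs s1) e')).
  apply: (good_sum _ dP Ps) => d; apply: order_in_cut => [||i z].
  - have [->|dd] := pselect (d = di).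
      have E i : (letters X \o s) i di = cs s1 i di.
        rewrite /cs; case: (unliftP ord0 i) => [j ->|->].
          by rewrite cons_letterS /letters /= !idx_di /X' s1E.
        by rewrite cons_letter0 /letters /= !idx_di s0.
      by move=> i j; rewrite !E.
    apply: order_in_homo; last exact: (cshomo s1 d dd s1inc).
    by move=> i j ij; rewrite /letters /= !idx_neq //; apply/tau_homo/sinc.
  - exact: push_down_order.
  - apply: (push_down_cut (X := X)) => //; first by exists (s i); rewrite /letters /= idx_di.
      exact: letters_bounds.
    exact: cs01.
(* Here non-brokenness enters: the tail stays indiscernible over the prepended [X 0], so the
   remaining letters can move into the chain. *)
have Pf1 : P (at_ y (sum_pos (cs f1) e')).
  apply: contrapT => nPf; apply: nb.
  pose m (q : ('I_k.+1 + 'I_N) * 'I_n) : ('I_k + (unit + 'I_N)) * 'I_n :=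
    (match q.1 with inl i => oapp inl (inr (inl tt)) (unlift ord0 i) | inr z => inr (inr z) end, q.2).
  have mE (g : 'I_k -> nat) : at_ y (sum_pos (cs g) e') =
      at_ y (sum_pos (letters X' \o g) (sum_pos (fun=> idx (X 0%N) (-1)) e')) \o m.
    apply/funext => -[[i|z] c] //; rewrite /at_ /m /= /cs /cons_letter.
    by case: (unlift ord0 i).
  exists (X 0%N), X', N, e', k, s1, f1, (fun w => P (w \o m)); split=> //.
  - move=> z; have [eXz ez] := eX z; split.
      by rewrite /e' /= push_down_di; case: eXz => H; [left|right]; split=> // l; exact: H.
    by move=> d dd; rewrite /e' /= push_down_neq //; case: (ez d dd) => H;
      [left|right]; case: ifP => H'; lra.
  - exact: dfn_comp.
  - by rewrite -!mE.
(* [X 0] is below the chain, so the new word increases in every dimension, like the one at [f]. *)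
apply: (good_sum _ dP Pf1) => d; apply: order_in_cut => [||i z].
- have [->|dd] := pselect (d = di).
    apply: order_in_homo; last first.
      by move=> i j ij; rewrite /letters /= !idx_di; exact: Xf.
    apply: cons_letter_homo => [i j ij|i]; rewrite /letters /= !idx_di.
      by apply: X'C; [exact: f1inc|exact: leq_addr].
    by apply: XC => //; rewrite ltnS leq_addr.
  apply: order_in_homo; first exact: (cshomo f1 d dd f1inc).
  by move=> i j ij; rewrite /letters /= !idx_neq //; apply/tau_homo/finc.
- by move=> i j; apply/esym/push_down_order.
- have := push_down_cut (X := X) (e := e z) (a := (letters X \o f) i) (b := cs f1 i) (d := d) (eX z).
  have H1 : exists l, (letters X \o f) i di = X l by exists (f i); rewrite /letters /= idx_di.
  by move=> /(_ H1 (csX _ _) (@letters_bounds _ _ _) (cs01 _ _ _)) [[? ?]|[? ?]]; [left|right].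
Qed.

End Broken.

(** * Dependence makes every dimension broken *)

Section AllBroken.
Context {L : language} {T : theory L} (C : monster T).
Variables (A : set C) (K K0 : Type) (n : nat) (p : set (pformula C n)).
Hypotheses (sA : small C A) (sK : smallT C K) (sK0 : smallT C K0).
Hypotheses (pA : forall f, p f -> params_in A f) (rk0 : rk_dp_lt A p K0) (n0 : (0 < n)%N).
Variables (l : K -> nat) (phi : forall i, ('I_n + 'I_(l i) -> C) -> Prop).
Arguments phi : clear implicits.
Hypothesis dphi : forall i, dfn A (phi i).

Definition separated i N (e : 'I_N -> bool) (v : 'I_N * 'I_n -> C) :=
  exists b : 'I_(l i) -> C, forall k, phi i (sum_asgn (fun c => v (k, c)) b) <-> e k.

Lemma dfn_separated i N (e : 'I_N.+1 -> bool) : dfn A (separated i e).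
Proof.
apply: (dfn_existsW (ord0, Ordinal n0) (P := fun v => forall k,
  phi i (sum_asgn (fun c => v (inl (k, c))) (v \o inr)) <-> e k)).
apply: dfn_forall_fin => k.
have d := dfn_comp (fun u => match u with inl c => inl (k, c) | inr w => inr w end :
  'I_N.+1 * 'I_n + 'I_(l i)) (dphi i).
have E (v : 'I_N.+1 * 'I_n + 'I_(l i) -> C) :
    v \o (fun u => match u with inl c => inl (k, c) | inr w => inr w end) =
    sum_asgn (fun c => v (inl (k, c))) (v \o inr) by apply/funext => -[].
case: (e k); [apply: dfn_ext d|apply: dfn_ext (dfn_not d)] => v; rewrite E.
  by split=> [h|[_ h]]; [split|exact: h].
by split=> [h|[h _] /h //]; split=> // /h.
Qed.

(** Two values are what the pattern controls: with the parameter at level [q'], [phi i] is true at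
    [q'] and false below it, while nothing is known above. *)
Definition alternating (y : fam C (option K) n) := forall i N (u : 'I_N.+1 -> option K -> rat) q q',
  q < q' -> (forall k, u k (Some i) = q \/ u k (Some i) = q') ->
  separated i (fun k => u k (Some i) == q') (at_ y u).

Lemma good_alternating_family (b : forall i, nat -> 'I_(l i) -> C) (a : (K -> nat) -> 'I_n -> C) :
  (forall eta, realizes (a eta) p) ->
  (forall eta i, phi i (sum_asgn (a eta) (b i (eta i)))) ->
  (forall eta i q, (eta i < q)%N -> ~ phi i (sum_asgn (a eta) (b i q))) ->
  exists y : fam C (option K) n, [/\ good A y, alternating y & forall eta, realizes (y eta) p].
Proof.
move=> ap aphi nphi.
pose Sp (c : condition C (option K) n) := exists (u : 'I_1 -> option K -> rat) f,
  p f /\ c = Condition u (fun v => holds (fun i => v (ord0, i)) f).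
pose Salt (c : condition C (option K) n) := exists i N (u : 'I_N.+1 -> option K -> rat) q q',
  [/\ q < q', forall k, u k (Some i) = q \/ u k (Some i) = q' &
    c = Condition u (separated i (fun k => u k (Some i) == q'))].
have [||y [ygood yP]] := good_family sA (smallT_option sK) (Sigma := fun c => Sp c \/ Salt c).
- move=> c [[u [f [pf ->]]]|[i [N [u [q [q' [_ _ ->]]]]]]]; last exact: dfn_separated.
  exact: (dfn_holds (fun i => (ord0, i)) (pA pf)).
- move=> cs csP.
  have [F FP] : exists F : seq (option K), forall c, List.In c cs -> Sp c \/
      exists i N (u : 'I_N.+1 -> option K -> rat) q q',
      [/\ q < q', forall k, u k (Some i) = q \/ u k (Some i) = q',
      c = Condition u (separated i (fun k => u k (Some i) == q')) & List.In (Some i) F].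
    elim: cs csP => [|c cs IH] csP; first by exists [::].
    have [F FP] := IH (fun c' h => csP c' (or_intror h)).
    have [Sc|[i [N [u [q [q' [qq' uq cE]]]]]]] := csP c (or_introl erefl).
      by exists F => c' /= [<-|/FP//]; left.
    exists (Some i :: F) => c' /= [<-|/FP[|[i' [N' [u' [r [r' [rr' ur cE' iF]]]]]]]].
    - by right; exists i, N, u, q, q'; split=> //; left.
    - by left.
    - by right; exists i', N', u', r, r'; split=> //; right.
  exists F, (fun eta => a (fun k => eta (Some k))) => c /FP[[u [f [pf ->]]]|].
    by move=> v _; exact: (ap (fun k => v ord0 (Some k)) f pf).
  move=> [i [N [u [q [q' [qq' uq -> iF]]]]]] /= v /(_ _ iF) uv.
  have [[k0 uk0]|nq'] := pselect (exists k, u k (Some i) = q').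
    exists (b i (v k0 (Some i))) => k /=; split=> [|/eqP uk].
      case: (uq k) => uk; last by rewrite uk eqxx.
      have vlt : (v k (Some i) < v k0 (Some i))%N by rewrite -uv uk uk0.
      by move=> /(nphi (fun k' => v k (Some k')) i _ vlt).
    have <- : v k (Some i) = v k0 (Some i).
      by apply/eqP; rewrite eqn_leq; apply/andP; split; rewrite leqNgt -uv uk uk0 ltxx.
    exact: (aphi (fun k' => v k (Some k'))).
  have uq0 k : u k (Some i) = q by case: (uq k) => // uk; case: nq'; exists k.
  (* No index takes the larger value, so a level just above the common value makes [phi i] false
     throughout. *)
  exists (b i (v ord0 (Some i)).+1) => k /=; split=> [|/eqP uk]; last by case: nq'; exists k.
  have <- : v k (Some i) = v ord0 (Some i).
    by apply/eqP; rewrite eqn_leq; apply/andP; split; rewrite leqNgt -uv !uq0 ltxx.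
  by move=> /(nphi (fun k' => v k (Some k')) i _ (ltnSn _)).
exists y; split=> // [i N u q q' qq' uq|eta f pf].
  by apply: (yP (Condition u (separated i (fun k => u k (Some i) == q')))); right; exists i, N, u, q, q'.
by apply: (yP (Condition (fun=> eta) (fun v => holds (fun i => v (ord0, i)) f))); left; exists (fun=> eta), f.
Qed.

(* Otherwise every word of letters 0 and 1 has the type of a fixed chain, so the
   chain is cut by phi in all ways, against [rk_dp_lt_nip]. *)
Lemma all_broken (y : fam C (option K) n) i : good A y -> alternating y ->
  (forall eta, realizes (y eta) p) -> broken A y (Some i).
Proof.
move=> ygood yalt yp; apply: contrapT => nb.
have [m] := rk_dp_lt_nip sA sK0 pA rk0 (dphi i); apply.
pose fs := enum {ffun 'I_m -> bool}; pose M := size fs.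
have M0 : (0 < M)%N by rewrite /M -cardE; apply/card_gt0P; exists [ffun=> true].
pose S k := nth [ffun=> true] fs k.
(* The first [M] letters spell column [j] of the table of all functions from ['I_m] to [bool]. The
   chain behind them does not depend on [j], so a single chain gets cut by all the columns. *)
pose X j k : rat := if (k < M)%N then (S k j)%:R else 1 + tau k.
have XC j : eventually_chain M (X j).
  move=> k k' kk' Mk'; rewrite /X (ltnNge k' M) Mk' /=.
  have t0 : 0 < tau k' := tau_homo (leq_ltn_trans (leq0n k) kk').
  case: ifP => _; last by rewrite ltrD2l tau_homo.
  by case: (S k j) => /=; lra.
have bX j : bounded_letters (X j).
  exists 2 => k; rewrite /X; case: ifP => _; first by case: (S k j).
  by have := tau_ge0 k; have := tau_lt1 k; rewrite ler_norml => ? ?; apply/andP; split; lra.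
pose word j (k : 'I_M.-1.+1) := letters (Some i) (X j) k.
pose chain (k : 'I_M.-1.+1) : option K -> rat := idx (Some i) (1 + tau (M + k)) (tau (M + k)).
have chainE j : letters (Some i) (X j) \o (fun k : 'I_M.-1.+1 => (M + k)%N) = chain.
  by apply/funext => k; rewrite /letters /= /X ltnNge leq_addr.
have sepc j : separated i (fun k => S k j) (at_ y chain).
  have e0 : 'I_0 -> option K -> rat by case.
  have := @eventually_chain_indiscernible _ _ _ _ _ _ _ ygood _ _ _ nb (bX j) (XC j) _
    (fun k : 'I_M.-1.+1 => val k) (fun k => (M + k)%N) 0%N e0.
  move=> /(_ _ _ _ (fun v => separated i (fun k => S k j) (fun q => v (inl q.1, q.2)))).
  have E u : (fun q : 'I_M.-1.+1 * 'I_n => at_ y (sum_pos u e0) (inl q.1, q.2)) = at_ y u.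
    by apply/funext => -[].
  rewrite !E chainE; apply => //; first by move=> k k' kk'; rewrite ltn_add2l.
    by case.
  - exact: (dfn_comp (fun q => (inl q.1, q.2)) (dfn_separated i _)).
  - have wE (k : 'I_M.-1.+1) : word j k (Some i) = (S k j)%:R.
      by rewrite /word /letters idx_di /X (leq_trans (ltn_ord k)) // prednK.
    have := yalt i M.-1 (word j) 0 1 ltr01.
    have -> : (fun k => word j k (Some i) == 1) = (fun k : 'I_M.-1.+1 => S k j).
      by apply/funext => k; rewrite wE; case: (S k j).
    by apply => k; rewrite wE; case: (S k j); [right|left].
have /choice[b bP] := sepc.
exists b => s; have rlt : (enum_rank (finfun s) < M.-1.+1)%N.
  by rewrite prednK // /M -cardE ltn_ord.
exists (y (chain (Ordinal rlt))); split=> [|j]; first exact: yp.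
by rewrite (bP j (Ordinal rlt)) /S /= nth_enum_rank ffunE.
Qed.

End AllBroken.

(** * Arranging all broken dimensions in one family *)

(* Leaves 0 fixed and moves the two half lines apart, so that different i in K
   occupy different shells around the common tuple at 0. *)
Definition spread (h w : rat) := w + Num.sg w * h.

Lemma spread_lt h : 0 <= h -> {mono spread h : w w' / w < w'}.
Proof.
move=> h0; apply/leW_mono/le_mono => w w'; rewrite /spread.
by case: (sgrP w) => w0; case: (sgrP w') => w'0; lra.
Qed.

Section Layout.
Context {L : language} {T : theory L} (C : monster T).
Variables (A : set C) (K : Type) (n : nat) (y : fam C (option K) n).
Hypothesis ygood : good A y.
Local Notation D := (option K).

Record config := Config {
  cx : rat; cX : nat -> rat; cN : nat; ce : 'I_cN -> D -> rat;
  ck : nat; cs : 'I_ck -> nat; ct : 'I_ck -> nat;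
  cP : (('I_ck + (unit + 'I_cN)) * 'I_n -> C) -> Prop }.

Definition config_word i (c : config) (s : 'I_(ck c) -> nat) :
    'I_(ck c) + (unit + 'I_(cN c)) -> D -> rat :=
  sum_pos (letters (Some i) (cX c) \o s) (sum_pos (fun=> idx (Some i) (cx c) (-1)) (@ce c)).

Definition breaks i (c : config) :=
  [/\ bounded_letters (cX c) /\ letters_indiscernible A y (Some i) (cX c),
      forall z, outside_cons (Some i) (cx c) (cX c) (@ce c z),
      {homo @cs c : i j / (i < j)%N} /\ {homo @ct c : i j / (i < j)%N}, dfn A (@cP c) &
      cP (at_ y (config_word i (@cs c))) /\ ~ cP (at_ y (config_word i (@ct c)))].

Lemma broken_config i : broken A y (Some i) -> exists c, breaks i c.
Proof.
move=> [x [X [N [e [k [s [t [P H]]]]]]]].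
by exists (@Config x X N e k s t P).
Qed.

Variable c : K -> config.
Hypothesis cb : forall i, breaks i (c i).

(** The indices of all configurations except the breaking letters, which will be identified with
    each other. *)
Definition node := {i : K & (nat + 'I_(cN (c i)))%type}.
Definition owner (o : node) := projT1 o.
Definition row_node i l : node := existT _ i (inl l).
Definition extra_node i z : node := existT _ i (inr z).

Definition coord (o : node) : D -> rat :=
  let: existT i u := o in
  match u with inl l => letters (Some i) (cX (c i)) l | inr z => @ce (c i) z end.

Definition base i := idx (Some i) (cx (c i)) (-1).
Definition offset (o : node) d := coord o d - base (owner o) d.

Lemma offset_row i l d : d <> Some i -> offset (row_node i l) d = tau l + 1.
Proof. by move=> dd; rewrite /offset /= /letters /base !idx_neq // opprK. Qed.

Lemma offset_extra i z d : d <> Some i ->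
  (@ce (c i) z d < -1 /\ offset (extra_node z) d < 0) \/ (1 <= @ce (c i) z d /\ 0 < offset (extra_node z) d).
Proof.
move=> dd; have [_ ez _ _ _] := cb i; have [_ /(_ d dd) H] := ez z.
by rewrite /offset /base /= idx_neq //; case: H => H; [left|right]; split=> //; lra.
Qed.

Lemma offset_neq0 o d : d <> Some (owner o) -> offset o d != 0.
Proof.
case: o => i [l|z] dd.
  by have -> := offset_row l dd; have := tau_ge0 l; lra.
by have [[_ H]|[_ H]] := offset_extra z dd; [rewrite lt_eqF|rewrite gt_eqF].
Qed.

(** The lower bound 2 serves [pull_far]: scaled by [B], a distance of 1 suffices to get from the
    letter at -1 up to 1. *)
Lemma offset_bounded : exists B : K -> D -> rat, forall i d, 2 <= B i d /\
  forall o, owner o = i -> `|offset o d| < B i d.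
Proof.
suff : forall i d, exists B : rat, 2 <= B /\ forall o, owner o = i -> `|offset o d| < B.
  move=> H; have /choice[B BP] : forall i, exists Bi : D -> rat, forall d, 2 <= Bi d /\
      forall o, owner o = i -> `|offset o d| < Bi d.
    by move=> i; have /choice[Bi BiP] := H i; exists Bi.
  by exists B.
move=> i d; have [[[b bP] _] _ _ _ _] := cb i.
pose e := \sum_z `|offset (@extra_node i z) d|.
have e0 : 0 <= e by apply: sumr_ge0.
have b0 : 0 <= b by apply: le_trans (bP 0%N).
have x0 : 0 <= `|cx (c i)| by [].
(* The offset of a row entry is at most [b] plus the absolute value of [cx (c i)] in dimension i and
   less than 2 in the others; [e] bounds the extra indices. *)
exists (2 + (b + `|cx (c i)| + e)); split=> [|[j [l|z]] /= ji]; first lra.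
  move: l; rewrite ji => l; have [->|dd] := pselect (d = Some i).
    rewrite /offset /= /letters /base !idx_di; have := bP l.
    by have := ler_normB (cX (c i) l) (cx (c i)); lra.
  have -> := offset_row l dd; have := tau_ge0 l; have := tau_lt1 l => t1 t0.
  by rewrite ger0_norm; lra.
move: z; rewrite ji => z; have : `|offset (extra_node z) d| <= e.
  by rewrite /e (bigD1 z) //= lerDl; apply: sumr_ge0.
by rewrite /extra_node; lra.
Qed.

Variable B : K -> D -> rat.
Hypothesis BP : forall i d, 2 <= B i d /\ forall o, owner o = i -> `|offset o d| < B i d.

Section Ranked.
Variable r : K -> nat.

(** In its own dimension a row stays around 0, where the common letter has to break it. Elsewhere
    the shells have width 1 and start at even numbers from 2 on, so there are gaps of width 1
    between ranks and around the interval (-1, 1). *)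
Definition height i (d : D) : rat := if pselect (d = Some i) then 0 else 2 * (r i).+1%:R.

Lemma height_own i : height i (Some i) = 0.
Proof. by rewrite /height; case: pselect. Qed.

Lemma height_neq i d : d <> Some i -> height i d = 2 * (r i).+1%:R.
Proof. by rewrite /height; case: pselect. Qed.

Lemma height_ge0 i d : 0 <= height i d.
Proof. by rewrite /height; case: pselect => //= dd; rewrite mulr_ge0. Qed.

Lemma B_gt0 i d : 0 < B i d.
Proof. by have [? _] := BP i d; lra. Qed.

(** [None] is the common letter. The other nodes are measured from the letter of their own
    configuration, scaled into (-1, 1) and moved to the shell of their owner. *)
Definition pos (o : option node) : D -> rat := fun d =>
  if o is Some o then spread (height (owner o) d) (offset o d / B (owner o) d) else 0.

Definition own_nodes i (s : 'I_(ck (c i)) -> nat) :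
    'I_(ck (c i)) + (unit + 'I_(cN (c i))) -> option node :=
  sum_pos (Some \o row_node i \o s) (sum_pos (fun=> None) (Some \o @extra_node i)).

Lemma own_nodes_pos i s q d : pos (@own_nodes i s q) d =
  spread (height i d) ((config_word i s q d - base i d) / B i d).
Proof.
by case: q => [q|[[]|z]] //=; rewrite /base subrr mul0r /spread sgr0 mul0r addr0.
Qed.

Lemma own_nodes_order i s d :
  order_in d (config_word i s) (pos \o @own_nodes i s).
Proof.
move=> q q'; rewrite /= !own_nodes_pos spread_lt ?height_ge0 //.
by rewrite ltr_pM2r ?invr_gt0 ?B_gt0 // ltrD2r.
Qed.

Lemma pos_breaks i : let Y o := y (pos o) in
  cP (at_ Y (@own_nodes i (@cs (c i)))) /\ ~ cP (at_ Y (@own_nodes i (@ct (c i)))).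
Proof.
have [_ _ _ dP [Ps nPt]] := cb i; split.
  exact: (ygood (own_nodes_order _) dP Ps).
exact: (ygood (own_nodes_order _) (dfn_not dP) nPt).
Qed.

(* Affine inverse of the layout on the row i; it sends all other nodes outside
   of that row. *)
Definition pull i d (w : rat) := base i d + B i d * (w - height i d).

Lemma pull_lt i d : {mono pull i d : w w' / w < w'}.
Proof. by move=> w w'; rewrite ltrD2l ltr_pM2l ?B_gt0 // ltrD2r. Qed.

Lemma pull_row i l d : pull i d (pos (Some (row_node i l)) d) = letters (Some i) (cX (c i)) l d.
Proof.
have B0 := B_gt0 i d; have Bn0 : B i d != 0 by rewrite gt_eqF.
rewrite /pull /= /spread; have [dd|dd] := pselect (d = Some i).
  subst d; rewrite height_own mulr0 addr0 subr0 mulrC divfK // /offset /=.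
  by rewrite addrC subrK.
have o0 : 0 < offset (row_node i l) d / B i d.
  by rewrite divr_gt0 // offset_row //; have := tau_ge0 l; lra.
rewrite gtr0_sg // mul1r addrK mulrC divfK // /offset /=.
by rewrite addrC subrK.
Qed.

Definition other i (o : node) := forall l, o <> row_node i l.

Lemma spread_far h w : 0 <= h -> w != 0 -> spread h w <= - h \/ h <= spread h w.
Proof. by move=> h0; rewrite /spread; case: (sgrP w) => // w0 _; [right|left]; lra. Qed.

Lemma frac_lt1 o d : `|offset o d / B (owner o) d| < 1.
Proof.
have B0 := B_gt0 (owner o) d; rewrite normrM [X in _ * X]ger0_norm ?invr_ge0 ?ltW //.
by rewrite ltr_pdivrMr // mul1r; have [_] := BP (owner o) d; apply.
Qed.

Lemma pull_far i d w : d <> Some i -> w <= height i d - 1 \/ height i d + 1 <= w ->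
  pull i d w < 0 \/ 1 <= pull i d w.
Proof.
move=> dd H; rewrite /pull /base idx_neq //; have [B2 _] := BP i d.
by case: H => H; [left|right]; nra.
Qed.

(** Other nodes of the same owner are extra indices, outside by the choice of the configuration. A
    node of another owner is at distance at least 2 from 0 in dimension [Some i]; in the remaining
    dimensions it is near 0 or in a shell of different rank or sign. *)
Lemma pull_outside i o : other i o -> (owner o <> i -> r (owner o) <> r i) ->
  outside (Some i) (cX (c i)) (fun d => pull i d (pos (Some o) d)).
Proof.
move=> oi ro; have [ji|ji] := pselect (owner o = i).
  have [z oE] : exists z : 'I_(cN (c i)), o = extra_node z.
    case: o ji oi {ro} => j [l|z] /= ji; last by move: z; rewrite ji => z _; exists z.
    by move: l; rewrite ji => l /(_ l).
  rewrite oE; have [_ /(_ z) [ez _] _ _ _] := cb i; split.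
    have -> : pull i (Some i) (pos (Some (extra_node z)) (Some i)) = @ce (c i) z (Some i).
      rewrite /pull /= /spread height_own mulr0 addr0 subr0 mulrC divfK ?gt_eqF ?B_gt0 //.
      by rewrite /offset /= addrC subrK.
    by case: ez => -[_ ?]; [left|right].
  move=> d dd; rewrite /pull /= /spread /base idx_neq //; have B0 := B_gt0 i d.
  have h0 := height_ge0 i d; have Bn0 : B i d != 0 by rewrite gt_eqF.
  have E : B i d * (offset (extra_node z) d / B i d) = offset (extra_node z) d by rewrite mulrC divfK.
  have oE' : offset (extra_node z) d = @ce (c i) z d + 1.
    by rewrite /offset /= /base idx_neq // opprK.
  have [[e1 o0]|[e1 o0]] := offset_extra z dd; [left|right].
    rewrite ltr0_sg; last by rewrite pmulr_llt0 ?invr_gt0.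
    by rewrite !mulrDr E; nra.
  rewrite gtr0_sg; last by rewrite divr_gt0.
  by rewrite mul1r addrK E; lra.
set j := owner o in ro ji; have f1 := frac_lt1 o; have B2 d := (BP i d).1.
split.
  have dd : Some i <> Some j by move=> [/esym].
  have o0 := offset_neq0 dd; rewrite /pull height_own subr0 /base idx_di.
  have w0 : offset o (Some i) / B j (Some i) != 0.
    by rewrite mulf_neq0 // invr_eq0 gt_eqF // B_gt0.
  have := spread_far (height_ge0 j (Some i)) w0; rewrite height_neq //.
  have rj : (1 : rat) <= (r j).+1%:R by rewrite ler1n.
  have bX l : `|cX (c i) l - cx (c i)| < B i (Some i).
    have [_ /(_ (row_node i l) erefl)] := BP i (Some i).
    by rewrite /offset /= /letters /base !idx_di.
  have := B2 (Some i); rewrite /= height_neq //; set w := spread _ _.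
  by move=> b2 [wh|wh]; [left|right] => l; have := bX l; rewrite ltr_norml => /andP[? ?]; nra.
move=> d dd; apply: (pull_far dd); rewrite height_neq //=.
have ri : (1 : rat) <= (r i).+1%:R by rewrite ler1n.
have := f1 d; rewrite ltr_norml => /andP[f1l f1r].
have [dj|dj] := pselect (d = Some j).
  by left; rewrite dj height_own /spread mulr0 addr0 -dj; lra.
rewrite -/j height_neq // /spread.
have rj : (1 : rat) <= (r j).+1%:R by rewrite ler1n.
case: (sgrP _) f1l f1r => [-> _ _|w0 f1l f1r|w0 f1l f1r]; [by left; lra| |by left; lra].
have [rr|rr|/(ro ji)//] := ltngtP (r j) (r i); [left|right].
  have : ((r j).+1%:R + 1 : rat) <= (r i).+1%:R by rewrite natr1 ler_nat.
  by lra.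
have : ((r i).+1%:R + 1 : rat) <= (r j).+1%:R by rewrite natr1 ler_nat.
by lra.
Qed.

(** [pull i] is increasing in every dimension, so it brings the row back to its original
    configuration without changing order types. *)
Lemma pos_row_indiscernible i k (s t : 'I_k -> nat) N (xs : 'I_N -> option node) :
  {homo s : i j / (i < j)%N} -> {homo t : i j / (i < j)%N} ->
  (forall z, exists2 o, xs z = Some o & other i o /\ (owner o <> i -> r (owner o) <> r i)) ->
  forall P : (('I_k + 'I_N) * 'I_n -> C) -> Prop, dfn A P ->
  let Y o := y (pos o) in
  P (at_ Y (sum_pos (Some \o row_node i \o s) xs)) -> P (at_ Y (sum_pos (Some \o row_node i \o t) xs)).
Proof.
move=> sinc tinc xsP P dP /=.
have [[_ ind] _ _ _ _] := cb i.
pose e z d := pull i d (pos (xs z) d).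
have eX z : outside (Some i) (cX (c i)) (e z).
  by have [o xo [oi ro]] := xsP z; rewrite /e xo; exact: pull_outside.
have ord (u : 'I_k -> nat) d : order_in d (pos \o sum_pos (Some \o row_node i \o u) xs)
    (sum_pos (letters (Some i) (cX (c i)) \o u) e).
  have E q : sum_pos (letters (Some i) (cX (c i)) \o u) e q d =
      pull i d (pos (sum_pos (Some \o row_node i \o u) xs q) d).
    by case: q => [q|z] //=; rewrite -pull_row.
  by move=> q q' /=; rewrite !E pull_lt.
move=> Ps; have Ps' := ygood (ord s) dP Ps.
have Pt' := ind _ _ _ _ _ sinc tinc eX P dP Ps'.
exact: (ygood (fun d q q' => esym (ord t d q q')) dP Pt').
Qed.

End Ranked.
End Layout.

Local Close Scope ring_scope.

Lemma list_rank (K : Type) (F : seq K) : exists r : K -> nat,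
  forall j j', List.In j F -> List.In j' F -> r j = r j' -> j = j'.
Proof.
exists (fun j => index (j : {classic K}) (F : seq {classic K})) => j j' /(@InP {classic K}) jF /(@InP {classic K}) j'F E.
by have := nth_index (j : {classic K}) jF; rewrite E nth_index.
Qed.

(** * From finitely many rows to all of K *)

Section Assembly.
Context {L : language} {T : theory L} (C : monster T).
Variables (A : set C) (K : Type) (n : nat) (p : set (pformula C n)) (y : fam C (option K) n).
Hypotheses (sA : small C A) (sK : smallT C K) (pA : forall f, p f -> params_in A f).
Hypotheses (ygood : good A y) (yp : forall eta, realizes (y eta) p).
Variable c : K -> config C K n.
Hypothesis cb : forall i, breaks A y i (c i).

Lemma smallT_node : smallT C (option (node c)).
Proof.
apply: smallT_option; apply: (@smallT_inj _ _ _ _ (K * (nat + nat))%type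
  (fun o => (projT1 o, match projT2 o with inl l => inl l | inr z => inr (val z) end))).
  move=> [i u] [i' u'] /= [ii]; case: i' / ii u' => u'.
  by case: u u' => [l|z] [l'|z'] //= => -[]; [move=> ->|move=> /val_inj ->].
apply: smallT_prod => //; exact: smallT_count.
Qed.

Definition arrangement (Y : option (node c) -> 'I_n -> C) := [/\ forall o, realizes (Y o) p,
  forall i, cP (at_ Y (own_nodes (@cs _ _ _ _ _ (c i)))) /\
    ~ cP (at_ Y (own_nodes (@ct _ _ _ _ _ (c i)))) &
  forall i k (s t : 'I_k -> nat) N (xs : 'I_N -> option (node c)),
    {homo s : i j / (i < j)%N} -> {homo t : i j / (i < j)%N} ->
    (forall z, exists2 o, xs z = Some o & other i o) ->
    forall P : (('I_k + 'I_N) * 'I_n -> C) -> Prop, dfn A P ->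
    P (at_ Y (sum_pos (Some \o row_node c i \o s) xs)) ->
    P (at_ Y (sum_pos (Some \o row_node c i \o t) xs))].

(** Finitely many conditions compare finitely many owners, and these can be given distinct ranks; no
    rank in [nat] need be injective on all of [K]. *)
Lemma arrangement_exists : exists Y, arrangement Y.
Proof.
have [B BP] := offset_bounded cb.
pose cur (v : option (node c) * 'I_n -> C) o k := v (o, k).
pose G1 : set ((option (node c) * 'I_n -> C) -> Prop) := [set Q | exists o f,
  p f /\ Q = fun v => holds (cur v o) f].
pose G2 : set ((option (node c) * 'I_n -> C) -> Prop) := [set Q | exists i,
  Q = fun v => cP (at_ (cur v) (own_nodes (@cs _ _ _ _ _ (c i)))) /\
    ~ cP (at_ (cur v) (own_nodes (@ct _ _ _ _ _ (c i))))].
pose G3 : set ((option (node c) * 'I_n -> C) -> Prop) := [set Q |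
  exists i k (s t : 'I_k -> nat) N (xs : 'I_N -> option (node c))
    (P : (('I_k + 'I_N) * 'I_n -> C) -> Prop),
  [/\ {homo s : i j / (i < j)%N} /\ {homo t : i j / (i < j)%N},
    forall z, exists2 o, xs z = Some o & other i o, dfn A P &
    Q = fun v => P (at_ (cur v) (sum_pos (Some \o row_node c i \o s) xs)) ->
      P (at_ (cur v) (sum_pos (Some \o row_node c i \o t) xs))]].
have sJ : smallT C (option (node c) * 'I_n).
  by apply: smallT_prod; [exact: smallT_node|exact: smallT_count].
have dat E (u : E -> option (node c)) (P : (E * 'I_n -> C) -> Prop) : dfn A P ->
    dfn A (fun v : option (node c) * 'I_n -> C => P (at_ (cur v) u)).
  exact: (dfn_comp (fun q : E * 'I_n => (u q.1, q.2))).
have [|Qs QsG|v vP] := compactness (Gamma := G1 `|` G2 `|` G3) sJ sA.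
- move=> _ [[[o [f [pf ->]]]|[i ->]]|[i [k [s [t [N [xs [P [_ _ dP ->]]]]]]]]].
  + exact: (dfn_holds (fun k => (o, k)) (pA pf)).
  + have [_ _ _ dP _] := cb i.
    by apply: dfn_and; [exact: dat|apply: dfn_not; exact: dat].
  + by apply: dfn_imp; exact: dat.
- have [F FP] : exists F : seq K, forall Q, List.In Q Qs -> forall r : K -> nat,
      (forall j j', List.In j F -> List.In j' F -> r j = r j' -> j = j') ->
      Q (fun q => y (pos B r q.1) q.2).
    elim: Qs QsG => [|Q Qs IH] QsG; first by exists [::].
    have [F FP] := IH (fun Q' h => QsG Q' (or_intror h)).
    have [[[o [f [pf QE]]]|[i QE]]|[i [k [s [t [N [xs [P [[sinc tinc] xsP dP QE]]]]]]]]] :=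
      QsG Q (or_introl erefl).
    + exists F => Q' /= [<-|/FP//] r _; rewrite QE; exact: (yp (pos B r o) pf).
    + exists F => Q' /= [<-|/FP//] r _; rewrite QE.
      exact: (pos_breaks ygood cb BP r i).
    + have /choice[w wP] : forall z, exists o, xs z = Some o /\ other i o.
        by move=> z; have [o xo oi] := xsP z; exists o.
      exists (i :: map (fun z => owner (w z)) (enum 'I_N) ++ F) => Q' /= [<-|Q'Qs] r rinj; last first.
        apply: FP => // j j' jF j'F; apply: rinj; right; apply/List.in_or_app; by right.
      rewrite QE; apply: (pos_row_indiscernible ygood cb BP sinc tinc _ dP) => z.
      have [xw wi] := wP z; exists (w z) => //; split=> // oi /(rinj _ _ _ _)/oi; apply.
        right; apply/List.in_or_app; left; apply/List.in_map_iff; exists z; split=> //.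
        by apply/InP; rewrite mem_enum.
      by left.
  have [r rinj] := list_rank F.
  by exists (fun q => y (pos B r q.1) q.2) => Q /FP; apply.
exists (cur v); split=> [o f pf|i|i k s t N xs sinc tinc xsP P dP].
- by apply: (vP (fun v => holds (cur v o) f)); left; left; exists o, f.
- by apply: (vP (fun v => cP (at_ (cur v) _) /\ ~ cP (at_ (cur v) _))); left; right; exists i.
- apply: (vP (fun v => P (at_ (cur v) _) -> P (at_ (cur v) _))); right.
  by exists i, k, s, t, N, xs, P.
Qed.

Lemma arrangement_rows : exists (A' : set C) (a : 'I_n -> C) (I : K -> sequence C n),
    [/\ A `<=` A' /\ small C A',
        realizes a p,
        (forall i, small C [set: sidx (I i)]) /\ mutually_indiscernible A' I,
        forall i, ~ indiscernible (A' `|` range a) (I i)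
      & forall i (o : sidx (I i)), realizes (I i o) p].
Proof.
have [Y [Yp Yb Yind]] := arrangement_exists.
pose E := [set d | exists i (z : 'I_(cN (c i))) k, d = Y (Some (extra_node z)) k].
(* The extra indices of all configurations become parameters; the common letter is left out of them
   and breaks the rows. *)
exists (A `|` E), (Y None), (fun i => row_sequence Y (fun l => Some (row_node c i l))); split.
- split; first exact: subsetUl.
  apply: smallU => //.
  apply: (small_range (smallT_prod smallT_node (@smallT_count _ _ _ 'I_n)) (f := fun q => Y q.1 q.2)).
  by move=> _ [i [z [k ->]]]; exists (Some (extra_node z), k).
- exact: Yp.
- split=> i; first exact: smallT_nat.
  apply: (row_sequence_indiscernible (A := A)
    (X := fun o => exists2 o', o = Some o' & other i o')).
    move=> d [[Ad|[j [z [k ->]]]]|[j ji [l [k <-]]]]; first by left.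
      by right; exists (Some (extra_node z)), k; split=> //; exists (extra_node z).
    right; exists (Some (row_node c j l)), k; split=> //; exists (row_node c j l) => // l'.
    by move=> /(congr1 (@owner _ _ _ _ _ _)).
  by move=> k s t N xs sinc tinc xsP P dP; exact: Yind.
- move=> i ind; have [_ _ [sinc tinc] dP _] := cb i; have [Ps nPt] := Yb i.
  pose S (q : ('I_(ck (c i)) + (unit + 'I_(cN (c i)))) * 'I_n) : 'I_(ck (c i)) * 'I_n + C :=
    match q.1 with
    | inl k => inl (k, q.2) | inr (inl _) => inr (Y None q.2)
    | inr (inr z) => inr (Y (Some (extra_node z)) q.2) end.
  have SA q d : S q = inr d -> (A `|` E `|` range (Y None)) d.
    case: q => -[q|[u|z]] k //= [<-]; first by right; exists k.
    by left; right; exists i, z, k.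
  have dP' := dfn_subst SA (dfn_subset _ dP).
  have inc (s : 'I_(ck (c i)) -> nat) : {homo s : i j / (i < j)%N} ->
      {homo s : i j / (i < j)%N >-> (i < j)%O}.
    by move=> H k k' /H; rewrite ltEnat.
  have /same_typeP H := ind _ _ _ (inc _ sinc) (inc _ tinc).
  have AS : A `<=` A `|` E `|` range (Y None) by move=> d Ad; left; left.
  have Es s : at_ Y (own_nodes s) = fun j => match S j with
      | inl q => row_sequence Y (fun l => Some (row_node c i l)) (s q.1) q.2 | inr d => d end.
    by apply/funext => -[[q|[[]|z]] k].
  have := H _ (dP' AS); rewrite -!Es => PE.
  by apply: nPt; apply/PE.
- by move=> i l; exact: Yp.
Qed.

End Assembly.

(** * Monotonicity of the rank bound, and the conclusion *)

Lemma indiscernible_subset L (T : theory L) (C : monster T) (B B' : set C) m (I : sequence C m) :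
  B `<=` B' -> indiscernible B' I -> indiscernible B I.
Proof. by move=> BB ind k s t sinc tinc N g f fB; apply: ind => // i; exact/BB/fB. Qed.

Lemma rk_dp_lt_inj L (T : theory L) (C : monster T) (A : set C) n (p : set (pformula C n))
    K0 K (f : K0 -> K) : injective f -> rk_dp_lt A p K0 -> rk_dp_lt A p K.
Proof.
move=> finj rk a m I ap sI mut.
have [i|i] := rk a (m \o f) (fun i => I (f i)) ap (fun i => sI (f i)); last by exists (f i).
apply: indiscernible_subset (mut (f i)) => d [Ad|[j ji Id]]; first by left.
by right; exists (f j) => //= /finj.
Qed.

Theorem theorem1p8 (L : language) (T : theory L) (hT : complete T)
    (C : monster T) (hNTP2 : NTP2 C)
    (n : nat) (A : set C) (hA : small C A)
    (p : set (pformula C n)) (hp : partial_type A p) (hdep : dependent A p)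
    (K : Type) (hrk : ~ rk_dp_lt A p K) :
  exists (A' : set C) (a : 'I_n -> C) (I : K -> sequence C n),
    [/\ A `<=` A' /\ small C A',
        realizes a p,
        (forall i, small C [set: sidx (I i)]) /\ mutually_indiscernible A' I,
        forall i, ~ indiscernible (A' `|` range a) (I i)
      & forall i (o : sidx (I i)), realizes (I i o) p].
Proof.
have [K0 [sK0 rk0]] := hdep; have [pA _] := hp.
(* Otherwise the small [K0] would embed into [K], and the rank bound would pass on to [K]. *)
have sK : smallT C K.
  by apply: contrapT => /(smallT_not_inj sK0)[f /rk_dp_lt_inj fP]; apply/hrk/fP.
have [a [m [I [ap mut nI]]]] : exists (a : 'I_n -> C) (m : K -> nat) (I : forall i, sequence C (m i)),
    [/\ realizes a p, mutually_indiscernible A I &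
      forall i, ~ indiscernible (A `|` range a) (I i)].
  apply: contrapT => H; apply: hrk => a m I ap _ mut; apply: contrapT => nI; apply: H.
  by exists a, m, I; split=> // i ind; apply: nI; exists i.
have [[i0]|K0'] := pselect (inhabited K); last first.
  have noK (i : K) : False by apply: K0'.
  by exists A, a, (fun i => False_rect _ (noK i)); split=> //; split=> // i; case: (noK i).
(* A sequence of empty tuples is indiscernible over every set, so the tuples of a broken row have
   positive length. *)
have q0 : posvar m.
  exists i0; split; first exact: 0.
  case E : (m i0) => [|k]; last exact: ord0.
  exfalso; apply: (nI i0) => k s t _ _; apply/same_typeP => P _.
  set u := (X in P X <-> _); set v := (X in _ <-> P X); suff -> : u = v by [].
  by apply/funext => -[l j]; exfalso; move: (leq_ltn_trans (leq0n j) (ltn_ord j)); rewrite E.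
have [W [phi [b [x [dphi xp xphi nphi]]]]] := ict_pattern mut hA sK pA ap nI q0.
(* For [n = 0] all the [x eta] coincide, but [phi i0] with the parameter at level 1 separates the
   functions constantly 0 and constantly 1. *)
have n0 : 0 < n.
  rewrite lt0n; apply/eqP => n0; have := nphi (fun=> 0) i0 1 isT.
  have -> : x (fun=> 0) = x (fun=> 1) by apply/funext => j; exfalso; move: (leq_ltn_trans (leq0n j) (ltn_ord j)); rewrite n0.
  by apply; exact: xphi.
pose num i (u : 'I_n + W i) : 'I_n + 'I_#|W i| :=
  match u with inl j => inl j | inr w => inr (enum_rank w) end.
have numE i z q : sum_asgn z (b i q \o enum_val) \o num i = sum_asgn z (b i q).
  by apply/funext => -[j|w] //=; rewrite enum_rankK.
have dphi' i : dfn A (fun v : 'I_n + 'I_#|W i| -> C => phi i (v \o num i)).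
  exact: dfn_comp.
have [||y [ygood yalt yp]] := good_alternating_family hA sK pA n0 dphi'
  (b := fun i q => b i q \o enum_val) xp.
- by move=> eta i; rewrite numE; exact: xphi.
- by move=> eta i q /nphi; rewrite numE.
have [c cb] := dep_choice (fun i => broken_config (all_broken hA sK0 pA rk0 n0 dphi' i ygood yalt yp)).
exact: (arrangement_rows hA sK pA ygood yp cb).
Qed.
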